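(* For every $n\geq 2$, the $n$-th symmetric product $SP^n\big(\bigvee_{i=1}^{n+1}S_i\big)$ of a bouquet of $n+1$ circles cannot be embedded in any product of $n$ curves.
   Context: A bouquet of circles $\bigvee_{i=1}^{n+1}S_i$ is a union of $n+1$ topological circles any two of which meet exactly in a common base point. $SP^n(X)$ is the orbit space of $X^n$ under the action of the symmetric group $S_n$ permuting coordinates. A curve is a $1$-dimensional continuum (compact connected metric space). *)

(* Defs.v *)
From Stdlib Require Import Reals List Lia Lra.
Open Scope R_scope.

Record MSpace := {
  mcar :> Type;
  mdist : mcar -> mcar -> R;
  mdist_nonneg : forall x y, 0 <= mdist x y;
  mdist_refl : forall x, mdist x x = 0;
  mdist_eq0 : forall x y, mdist x y = 0 -> x = y;
  mdist_sym : forall x y, mdist x y = mdist y x;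
  mdist_tri : forall x y z, mdist x z <= mdist x y + mdist y z
}.

Definition is_open (X : MSpace) (U : X -> Prop) : Prop :=
  forall x, U x -> exists e, 0 < e /\ forall y, mdist X x y < e -> U y.

Definition compact (X : MSpace) : Prop :=
  forall (I : Type) (U : I -> X -> Prop),
    (forall i, is_open X (U i)) -> (forall x, exists i, U i x) ->
    exists l : list I, forall x, exists i, In i l /\ U i x.

Definition connected (X : MSpace) : Prop :=
  ~ exists U V : X -> Prop, is_open X U /\ is_open X V /\
      (exists x, U x) /\ (exists x, V x) /\
      (forall x, U x \/ V x) /\ (forall x, ~ (U x /\ V x)).

Definition empty_set (X : Type) : X -> Prop := fun _ => False.

Definition order_le (X : Type) (l : list (X -> Prop)) (m : nat) : Prop :=
  forall (x : X) (idx : list nat), NoDup idx ->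
    (forall i, In i idx -> (i < length l)%nat /\ nth i l (empty_set X) x) ->
    (length idx <= m)%nat.

Definition is_cover (X : Type) (l : list (X -> Prop)) : Prop :=
  forall x, exists U, In U l /\ U x.

Definition covdim_le (X : MSpace) (k : nat) : Prop :=
  forall l : list (X -> Prop),
    (forall U, In U l -> is_open X U) -> is_cover X l ->
    exists l' : list (X -> Prop),
      (forall V, In V l' -> is_open X V) /\ is_cover X l' /\
      (forall V, In V l' -> exists U, In U l /\ forall x, V x -> U x) /\
      order_le X l' (S k).

Definition dim_eq_1 (X : MSpace) : Prop := covdim_le X 1 /\ ~ covdim_le X 0.

Definition curve (X : MSpace) : Prop := compact X /\ connected X /\ dim_eq_1 X.

(** * Bouquet of n+1 circles, concrete model in R^2:
    circles C_k : x^2 + y^2 = 2 k x  (k = 1..n+1), all passing through the origin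
    and pairwise meeting only there. *)
Definition bouquet (n : nat) : Type :=
  { p : R * R | exists k : nat, (1 <= k <= n + 1)%nat /\
      fst p * fst p + snd p * snd p = 2 * INR k * fst p }.

Definition bdist (n : nat) (p q : bouquet n) : R :=
  let a := proj1_sig p in let b := proj1_sig q in
  sqrt ((fst a - fst b) * (fst a - fst b) + (snd a - snd b) * (snd a - snd b)).

Definition Idx (n : nat) : Type := { i : nat | (i < n)%nat }.

Definition is_perm (n : nat) (s : Idx n -> Idx n) : Prop :=
  exists g : Idx n -> Idx n, (forall i, g (s i) = i) /\ (forall i, s (g i) = i).

(** * Embedding of SP^n(B) into a product of metric spaces Y_0 x ... x Y_{n-1}.
    A map on SP^n(B) = B^n / S_n is given by a map f : B^n -> prod Y that is
    constant on S_n-orbits.  It is an embedding (homeomorphism onto its image)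
    iff it is continuous and its inverse on the image is continuous, where
    SP^n(B) carries the quotient metric
       d([x],[x']) = min_s max_i d(x_i, x'_{s i})
    and products carry the max metric (written coordinatewise below). *)
Definition SP_embedding (n : nat) (Y : Idx n -> MSpace)
  (f : (Idx n -> bouquet n) -> (forall j : Idx n, Y j)) : Prop :=
  (forall x s, is_perm n s -> f (fun i => x (s i)) = f x) /\
  (forall x eps, 0 < eps -> exists delta, 0 < delta /\
     forall x', (forall i, bdist n (x i) (x' i) < delta) ->
       forall j, mdist (Y j) (f x j) (f x' j) < eps) /\
  (* continuity of the inverse on the image (implies injectivity on SP^n) *)
  (forall x eps, 0 < eps -> exists delta, 0 < delta /\
     forall x', (forall j, mdist (Y j) (f x j) (f x' j) < delta) ->
       exists s, is_perm n s /\ forall i, bdist n (x i) (x' (s i)) < eps).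

(* Main.v *)
(* Cohomologically: the degree-n cohomology of SP^n(B) is the n-th exterior power of H^1 = Z^(n+1), of rank n+1.
   Cup products of two classes pulled back from a curve vanish, so the classes pulled back from each factor span
   at most a line in H^1; since H^n of a product of n curves restricts onto H^n of an n-dimensional closed subset
   and is generated by products of such classes, an embedding would make the rank at most 1.

   This is carried out on finite grids. Fine covers of order 2 of the curves label the grid points of the n-tori
   in SP^n(B) (products of circles) in such a way that every small cube sees at most two labels for each factor.
   A nonzero integer combination of these tori is killed by every product of 1-cocycles read off from the labels,
   hence, the labels being fine, by every n-cochain that depends on the labels only. The product of suitable
   angle cocycles is such a cochain and does not kill the combination. *)

(* The obstacle is that the angle cocycles live on the bouquet while the vanishing of products is a
   property of the curves. Two devices bring both to the same cochains. A cell of the grid carries,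
   for each factor, the set of labels of its faces. These sets grow with the cell and have at most
   two elements, so along a maximal flag of cells each factor changes at most once; products can
   therefore be controlled flag by flag, not only in cohomology. Moreover the inverse of the
   embedding is uniformly continuous, so cells with equal label sets in all factors are close up to
   a permutation, and the angle cocycles can be rounded to functions of the label sets at the cost
   of a coboundary. The n + 1 tori share n - 1 of their circles. Their period matrices differ in one
   column only, so a combination of the tori acts on a product of 1-cocycles through the same
   combination of that column. Its coefficients form a vector [c] orthogonal to one line per factor,
   and the shared circles avoid an index [k0] with [c k0] nonzero, so that the angle product singles
   out the torus of [k0]. *)
Require Import Defs.
From Stdlib Require Import Reals List Lia Lra Psatz ZArith.
From Stdlib Require Import Classical ClassicalEpsilon FunctionalExtensionality.
Open Scope R_scope.

(** * Compactness and small labellings of the bouquet *)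

(* Compactness is used in this form: an ideal of subsets that contains a neighbourhood of every point of a compact
   set contains that set. *)
Definition ideal (T : Type) (G : (T -> Prop) -> Prop) : Prop :=
  G (fun _ => False) /\
  (forall A B, G A -> G B -> G (fun x => A x \/ B x)) /\
  (forall A B : T -> Prop, (forall x, A x -> B x) -> G B -> G A).

(** Heine-Borel by a supremum: take the last [t] for which the segment from [a] to [t] belongs to
    [G]; a neighbourhood of it in [G] pushes it further. *)
Lemma ideal_segment (G : (R -> Prop) -> Prop) (a b : R) : ideal R G -> a <= b ->
  (forall t, a <= t <= b -> exists r, 0 < r /\ G (fun x => Rabs (x - t) < r)) ->
  G (fun x => a <= x <= b).
Proof.
  intros [G0 [GU GS]] ab loc.
  pose (E := fun t => a <= t <= b /\ G (fun x => a <= x <= t)).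
  assert (Ea : E a).
  { split; [lra|]. destruct (loc a) as [r [r0 Hr]]; [lra|].
    apply GS with (2 := Hr). intros x Hx. apply Rabs_def1; lra. }
  destruct (completeness E) as [s [ub lub]].
  { exists b. intros t [Ht _]. lra. }
  { exists a. exact Ea. }
  assert (sa : a <= s) by (apply ub; exact Ea).
  assert (sb : s <= b) by (apply lub; intros t [Ht _]; lra).
  destruct (loc s) as [r [r0 Hr]]; [lra|].
  assert (exists t, E t /\ s - r < t <= s) as [t [[Ht Gt] ts]].
  { apply NNPP. intro N. assert (s <= s - r); [|lra].
    apply lub. intros t Et. apply Rnot_lt_le. intro C. apply N. exists t.
    split; [exact Et|]. split; [exact C|]. apply ub, Et. }
  assert (Gm : forall u, u < s + r -> G (fun x => a <= x <= u)).
  { intros u Hu. apply GS with (2 := GU _ _ Gt Hr). intros x Hx.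
    destruct (Rle_lt_dec x t); [left; lra|right; apply Rabs_def1; lra]. }
  destruct (Rlt_le_dec b (s + r)) as [C|C]; [apply Gm, C|].
  assert (E (s + r / 2)) as E1 by (split; [lra|apply Gm; lra]).
  apply ub in E1. lra.
Qed.

(** * Metric geometry and compactness of the bouquet and its powers *)

Lemma bdist_euc n (p q : bouquet n) : bdist n p q =
  dist_euc (fst (proj1_sig p)) (snd (proj1_sig p)) (fst (proj1_sig q)) (snd (proj1_sig q)).
Proof. reflexivity. Qed.

Lemma bdist_sym n p q : bdist n p q = bdist n q p.
Proof. rewrite !bdist_euc. apply distance_symm. Qed.

Lemma bdist_tri n p q r : bdist n p r <= bdist n p q + bdist n q r.
Proof. rewrite !bdist_euc. apply triangle. Qed.

Lemma bdist_sqr n p q : bdist n p q * bdist n p q =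
  (fst (proj1_sig p) - fst (proj1_sig q)) ^ 2 + (snd (proj1_sig p) - snd (proj1_sig q)) ^ 2.
Proof.
  unfold bdist. rewrite sqrt_sqrt; [ring|].
  apply Rplus_le_le_0_compat; apply Rle_0_sqr.
Qed.

Lemma bdist_pos n p q : 0 <= bdist n p q.
Proof. apply sqrt_pos. Qed.

Lemma bouquet_eq n (p q : bouquet n) : proj1_sig p = proj1_sig q -> p = q.
Proof.
  destruct p as [p Hp], q as [q Hq]; simpl. intros <-. f_equal. apply proof_irrelevance.
Qed.

(** Circles are numbered from 0 here and from 1 in [bouquet], hence the shift; the [Nat.min] makes
    [bpt] total in [k]. The angle is measured from the common base point, which is [u = 0] on every
    circle. *)
Definition radius (n k : nat) : R := INR (Nat.min k n + 1).
Definition circle_pt (n k : nat) (u : R) : R * R :=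
  (radius n k * (1 - cos u), radius n k * sin u).

Lemma circle_pt_bouquet n k u : exists k', (1 <= k' <= n + 1)%nat /\
  fst (circle_pt n k u) * fst (circle_pt n k u) + snd (circle_pt n k u) * snd (circle_pt n k u)
  = 2 * INR k' * fst (circle_pt n k u).
Proof.
  exists (Nat.min k n + 1)%nat. split; [lia|].
  unfold circle_pt, radius; simpl fst; simpl snd.
  set (K := INR (Nat.min k n + 1)). pose proof (sin2_cos2 u) as H. unfold Rsqr in H.
  replace (K * (1 - cos u) * (K * (1 - cos u)) + K * sin u * (K * sin u))
    with (K * K * (1 - 2 * cos u + (sin u * sin u + cos u * cos u))) by ring.
  rewrite H. ring.
Qed.

Definition bpt (n k : nat) (u : R) : bouquet n := exist _ (circle_pt n k u) (circle_pt_bouquet n k u).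

Lemma radius_ge1 n k : 1 <= radius n k.
Proof. unfold radius. rewrite plus_INR. pose proof (pos_INR (Nat.min k n)). simpl; lra. Qed.

Lemma radius_le n k : radius n k <= INR (n + 1).
Proof. apply le_INR. lia. Qed.

Lemma one_minus_cos u : 1 - cos u = 2 * (sin (u / 2) * sin (u / 2)).
Proof.
  replace u with (2 * (u / 2)) at 1 by field. rewrite cos_2a_sin. ring.
Qed.

Lemma bpt_dist n k u v : bdist n (bpt n k u) (bpt n k v) * bdist n (bpt n k u) (bpt n k v) =
  4 * (radius n k * radius n k) * (sin ((u - v) / 2) * sin ((u - v) / 2)).
Proof.
  rewrite bdist_sqr. simpl fst; simpl snd. set (K := radius n k).
  pose proof (one_minus_cos (u - v)) as H. rewrite cos_minus in H.
  pose proof (sin2_cos2 u) as Hu. pose proof (sin2_cos2 v) as Hv. unfold Rsqr in Hu, Hv.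
  replace (4 * (K * K) * (sin ((u - v) / 2) * sin ((u - v) / 2))) with
    (2 * (K * K) * (2 * (sin ((u - v) / 2) * sin ((u - v) / 2)))) by ring.
  rewrite <- H.
  replace ((K * (1 - cos u) - K * (1 - cos v)) ^ 2 + (K * sin u - K * sin v) ^ 2) with
   (K * K * ((sin u * sin u + cos u * cos u) + (sin v * sin v + cos v * cos v)
     - 2 * (cos u * cos v + sin u * sin v))) by ring.
  rewrite Hu, Hv. ring.
Qed.

Lemma sin_sqr_le x : sin x * sin x <= x * x.
Proof.
  assert (P : forall y, 0 <= y -> sin y * sin y <= y * y).
  { intros y y0. destruct (Rle_lt_dec 1 y) as [C|C].
    - pose proof (SIN_bound y). nra.
    - destruct (Req_dec y 0) as [->|ne]; [rewrite sin_0; lra|].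
      assert (sin y < y) by (apply sin_lt_x; lra).
      assert (0 <= sin y) by (apply sin_ge_0; [lra|]; pose proof PI2_1; lra).
      nra. }
  destruct (Rle_lt_dec 0 x) as [C|C]; [apply P, C|].
  specialize (P (- x)). rewrite sin_neg in P. nra.
Qed.

Lemma bpt_lip n k u v : bdist n (bpt n k u) (bpt n k v) <= INR (n + 1) * Rabs (u - v).
Proof.
  pose proof (bpt_dist n k u v) as E. pose proof (bdist_pos n (bpt n k u) (bpt n k v)) as P.
  pose proof (radius_ge1 n k) as K1. pose proof (radius_le n k) as K2.
  pose proof (sin_sqr_le ((u - v) / 2)) as S.
  assert (Rabs (u - v) * Rabs (u - v) = (u - v) * (u - v)) as A.
  { rewrite <- Rabs_mult. apply Rabs_pos_eq. apply Rle_0_sqr. }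
  pose proof (Rabs_pos (u - v)) as A0.
  set (b := bdist _ _ _) in *. set (K := radius n k) in *. set (N := INR (n + 1)) in *.
  set (w := Rabs (u - v)) in *.
  apply Rsqr_incr_0_var; [|apply Rmult_le_pos; lra]. unfold Rsqr.
  rewrite E.
  apply Rle_trans with (K * K * (w * w)); [rewrite A; nra|].
  assert (K * K <= N * N) by nra. nra.
Qed.

Definition on_circles n (p : bouquet n) : Prop :=
  exists k u, (k <= n)%nat /\ 0 <= u <= 2 * PI /\ p = bpt n k u.

Lemma ideal_circles n (G : (bouquet n -> Prop) -> Prop) : ideal _ G ->
  (forall c, exists r, 0 < r /\ G (fun p => on_circles n p /\ bdist n c p < r)) ->
  G (on_circles n).
Proof.
  intros I loc. pose proof I as [G0 [GU GS]].
  assert (C : forall k, (k <= n)%nat -> G (fun p => exists u, 0 <= u <= 2 * PI /\ p = bpt n k u)).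
  { intros k kn. pose (H := fun S : R -> Prop => G (fun p => exists u, 0 <= u <= 2 * PI /\ S u /\ p = bpt n k u)).
    assert (HI : ideal R H).
    { unfold H. split; [|split].
      - apply GS with (2 := G0). intros p [u [_ [[] _]]].
      - intros A B GA GB. apply GS with (2 := GU _ _ GA GB).
        intros p [u [Hu [[HA|HB] E]]]; [left|right]; exists u; auto.
      - intros A B AB GB. apply GS with (2 := GB). intros p [u [Hu [HA E]]]. exists u; auto. }
    assert (HG : H (fun u => 0 <= u <= 2 * PI)).
    { apply ideal_segment; [exact HI| pose proof PI_RGT_0; lra|].
      intros t Ht. destruct (loc (bpt n k t)) as [r [r0 Hr]].
      assert (N0 : 0 < INR (n + 1)) by (apply lt_0_INR; lia).
      exists (r / INR (n + 1)). split; [apply Rdiv_lt_0_compat; lra|].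
      apply GS with (2 := Hr). intros p [u [Hu [Hut ->]]]. split; [exists k, u; auto|].
      apply Rle_lt_trans with (1 := bpt_lip n k t u). rewrite Rabs_minus_sym.
      apply Rmult_lt_compat_l with (1 := N0) in Hut.
      replace (INR (n + 1) * (r / INR (n + 1))) with r in Hut by (field; lra). exact Hut. }
    apply GS with (2 := HG). intros p [u [Hu E]]. exists u; auto. }
  assert (F : forall m, G (fun p => exists k u, (k < m)%nat /\ (k <= n)%nat /\ 0 <= u <= 2 * PI /\ p = bpt n k u)).
  { induction m as [|m IH].
    - apply GS with (2 := G0). intros p [k [u [Hk _]]]. lia.
    - destruct (le_lt_dec m n) as [mn|mn].
      + apply GS with (2 := GU _ _ IH (C m mn)). intros p [k [u [Hk [kn [Hu E]]]]].
        destruct (Nat.eq_dec k m) as [->|ne]; [right; exists u; auto|].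
        left; exists k, u. repeat split; auto; lia || lra.
      + apply GS with (2 := IH). intros p [k [u [Hk [kn [Hu E]]]]].
        exists k, u. repeat split; auto; lia || lra. }
  apply GS with (2 := F (S n)). intros p [k [u [kn [Hu E]]]]. exists k, u. repeat split; auto; lia || lra.
Qed.

Lemma idx_eq n (i j : Idx n) : proj1_sig i = proj1_sig j -> i = j.
Proof. destruct i as [i Hi], j as [j Hj]; simpl. intros <-. f_equal. apply proof_irrelevance. Qed.

Definition upd (n : nat) (T : Type) (c : Idx n -> T) (m : nat) (b : T) : Idx n -> T :=
  fun i => if Nat.eq_dec (proj1_sig i) m then b else c i.

(** Tychonoff for finitely many factors by the tube lemma: the coordinates below [m] are already
    unrestricted, and one more is freed at each step. *)
Lemma ideal_product n (G : ((Idx n -> bouquet n) -> Prop) -> Prop) : ideal _ G ->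
  (forall c, exists r, 0 < r /\ G (fun x => (forall i, on_circles n (x i)) /\ forall i, bdist n (c i) (x i) < r)) ->
  G (fun x => forall i, on_circles n (x i)).
Proof.
  intros I loc. pose proof I as [G0 [GU GS]].
  assert (F : forall m c, exists r, 0 < r /\ G (fun x => (forall i, on_circles n (x i)) /\
     forall i, (m <= proj1_sig i)%nat -> bdist n (c i) (x i) < r)).
  { induction m as [|m IH]; intro c.
    - destruct (loc c) as [r [r0 Hr]]. exists r. split; [exact r0|].
      apply GS with (2 := Hr). intros x [H1 H2]. split; [exact H1|]. intro i. apply H2. lia.
    - destruct (le_lt_dec n m) as [nm|mn].
      { destruct (IH c) as [r [r0 Hr]]. exists r. split; [exact r0|].
        apply GS with (2 := Hr). intros x [H1 H2]. split; [exact H1|].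
        intros i Hi. pose proof (proj2_sig i) as L. simpl in L. lia. }
      pose (i0 := exist (fun i => (i < n)%nat) m mn : Idx n).
      (* With the later coordinates held near [c], [G] induces an ideal on the single coordinate
         [m], to which compactness of the bouquet applies. *)
      pose (H := fun A : bouquet n -> Prop => exists r, 0 < r /\ G (fun x => (forall i, on_circles n (x i)) /\
        A (x i0) /\ forall i, (S m <= proj1_sig i)%nat -> bdist n (c i) (x i) < r)).
      assert (HI : ideal _ H).
      { unfold H. split; [|split].
        - exists 1. split; [lra|]. apply GS with (2 := G0). intros x [_ [[] _]].
        - intros A B [ra [ra0 GA]] [rb [rb0 GB]]. exists (Rmin ra rb).
          split; [apply Rmin_glb_lt; assumption|].
          apply GS with (2 := GU _ _ GA GB). intros x [H1 [[HA|HB] H2]]; [left|right];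
          (split; [exact H1|split; [assumption|]]); intros i Hi; specialize (H2 i Hi);
          pose proof (Rmin_l ra rb); pose proof (Rmin_r ra rb); lra.
        - intros A B AB [r [r0 GB]]. exists r. split; [exact r0|].
          apply GS with (2 := GB). intros x [H1 [HA H2]]. auto. }
      assert (HG : H (on_circles n)).
      { apply ideal_circles; [exact HI|]. intro b.
        destruct (IH (upd n _ c m b)) as [r [r0 Hr]]. exists r. split; [exact r0|].
        exists r. split; [exact r0|]. apply GS with (2 := Hr).
        intros x [H1 [[_ H2] H3]]. split; [exact H1|]. intros i Hi. unfold upd.
        destruct (Nat.eq_dec (proj1_sig i) m) as [E|ne].
        - replace i with i0 by (apply idx_eq; symmetry; exact E). exact H2.
        - apply H3. lia. }
      destruct HG as [r [r0 Hr]]. exists r. split; [exact r0|].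
      apply GS with (2 := Hr). intros x [H1 H2]. auto. }
  destruct (F n (fun _ => bpt n 0 0)) as [r [r0 Hr]].
  apply GS with (2 := Hr). intros x H1. split; [exact H1|].
  intros i Hi. pose proof (proj2_sig i) as L. simpl in L. lia.
Qed.

(** * Uniform continuity of the embedding and of its inverse *)

Section Uniform.
Variables (n : nat) (Y : Idx n -> MSpace) (f : (Idx n -> bouquet n) -> forall j, Y j).
Hypothesis emb : SP_embedding n Y f.

Lemma embedding_unif_cont eps : 0 < eps -> exists eta, 0 < eta /\
  forall x x', (forall i, on_circles n (x i)) -> (forall i, bdist n (x i) (x' i) < eta) ->
  forall j, mdist (Y j) (f x j) (f x' j) < eps.
Proof.
  intro e0. destruct emb as [_ [cont _]].
  pose (G := fun S : (Idx n -> bouquet n) -> Prop => exists eta, 0 < eta /\ forall x x', S x ->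
    (forall i, bdist n (x i) (x' i) < eta) -> forall j, mdist (Y j) (f x j) (f x' j) < eps).
  assert (HG : G (fun x => forall i, on_circles n (x i))).
  { apply ideal_product.
    - split; [|split].
      + exists 1. split; [lra|]. intros x x' [].
      + intros A B [a [a0 HA]] [b [b0 HB]]. exists (Rmin a b).
        split; [apply Rmin_glb_lt; assumption|].
        pose proof (Rmin_l a b); pose proof (Rmin_r a b).
        intros x x' [H1|H1] H2; [apply HA|apply HB]; auto; intro i; specialize (H2 i); lra.
      + intros A B AB [b [b0 HB]]. exists b. split; [exact b0|]. intros x x' HA; apply HB; auto.
    - intro c. destruct (cont c (eps / 2)) as [d [d0 Hd]]; [lra|].
      exists (d / 2). split; [lra|]. exists (d / 2). split; [lra|].
      intros x x' [_ H1] H2 j.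
      assert (A : mdist (Y j) (f c j) (f x j) < eps / 2) by (apply Hd; intro i; specialize (H1 i); lra).
      assert (B : mdist (Y j) (f c j) (f x' j) < eps / 2).
      { apply Hd. intro i. specialize (H1 i). specialize (H2 i).
        pose proof (bdist_tri n (c i) (x i) (x' i)). lra. }
      pose proof (mdist_tri (Y j) (f x j) (f c j) (f x' j)).
      rewrite (mdist_sym (Y j) (f x j) (f c j)) in *. lra. }
  destruct HG as [eta [eta0 H]]. exists eta. split; [exact eta0|]. intros x x' Hx. apply H, Hx.
Qed.

(** Near a centre [c], continuity of [f] lets the hypothesis on [f x] be replaced by one on [f c];
    the permutation that matches [c] with [x'] then also matches [x] with [x']. *)
Lemma embedding_unif_inv eps : 0 < eps -> exists eta, 0 < eta /\
  forall x x', (forall i, on_circles n (x i)) -> (forall j, mdist (Y j) (f x j) (f x' j) < eta) ->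
  exists s, is_perm n s /\ forall i, bdist n (x i) (x' (s i)) < eps.
Proof.
  intro e0. destruct emb as [_ [cont inv]].
  pose (G := fun S : (Idx n -> bouquet n) -> Prop => exists eta, 0 < eta /\ forall x x', S x ->
    (forall j, mdist (Y j) (f x j) (f x' j) < eta) ->
    exists s, is_perm n s /\ forall i, bdist n (x i) (x' (s i)) < eps).
  assert (HG : G (fun x => forall i, on_circles n (x i))).
  { apply ideal_product.
    - split; [|split].
      + exists 1. split; [lra|]. intros x x' [].
      + intros A B [a [a0 HA]] [b [b0 HB]]. exists (Rmin a b).
        split; [apply Rmin_glb_lt; assumption|].
        pose proof (Rmin_l a b); pose proof (Rmin_r a b).
        intros x x' [H1|H1] H2; [apply HA|apply HB]; auto; intro i; specialize (H2 i); lra.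
      + intros A B AB [b [b0 HB]]. exists b. split; [exact b0|]. intros x x' HA; apply HB; auto.
    - intro c. destruct (inv c (eps / 2)) as [d [d0 Hd]]; [lra|].
      destruct (cont c (d / 2)) as [r [r0 Hr]]; [lra|].
      pose proof (Rmin_l r (eps / 2)); pose proof (Rmin_r r (eps / 2)).
      exists (Rmin r (eps / 2)). split; [apply Rmin_glb_lt; lra|].
      exists (d / 2). split; [lra|].
      intros x x' [_ H1] H2. destruct (Hd x') as [s [ps Hs]].
      { intro j. assert (A : mdist (Y j) (f c j) (f x j) < d / 2) by (apply Hr; intro i; specialize (H1 i); lra).
        specialize (H2 j). pose proof (mdist_tri (Y j) (f c j) (f x j) (f x' j)). lra. }
      exists s. split; [exact ps|]. intro i. specialize (H1 i). specialize (Hs i).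
      pose proof (bdist_tri n (x i) (c i) (x' (s i))). rewrite (bdist_sym n (x i) (c i)) in *. lra. }
  destruct HG as [eta [eta0 H]]. exists eta. split; [exact eta0|]. intros x x' Hx. apply H, Hx.
Qed.
End Uniform.

(** * Labelling a curve by a fine cover of order two *)

Lemma open_ball (X : MSpace) (c : X) (r : R) : is_open X (fun y => mdist X c y < r).
Proof.
  intros x Hx. exists (r - mdist X c x). split; [lra|].
  intros y Hy. pose proof (mdist_tri X c x y). lra.
Qed.

(** The label of [y] names a member of the cover that contains the whole [lam]-ball of [y], where
    [lam] is a Lebesgue number. So [y1] lies in the members named by [y2] and [y3] too, and three
    different labels would violate the order bound. *)
Lemma curve_labelling (X : MSpace) (eps : R) : Defs.compact X -> covdim_le X 1 -> 0 < eps ->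
  exists (N : nat) (lab : X -> nat) (lam : R), 0 < lam /\ (forall y, (lab y < N)%nat) /\
  (forall y y', lab y = lab y' -> mdist X y y' < eps) /\
  (forall y1 y2 y3, mdist X y1 y2 < lam -> mdist X y1 y3 < lam ->
     lab y1 = lab y2 \/ lab y2 = lab y3 \/ lab y3 = lab y1).
Proof.
  intros cpt dim e0.
  destruct (cpt X (fun c y => mdist X c y < eps / 2)) as [lc Hlc].
  { intro c. apply open_ball. }
  { intro x. exists x. rewrite mdist_refl. lra. }
  destruct (dim (map (fun c y => mdist X c y < eps / 2) lc)) as [l [lo [lcov [lref lord]]]].
  { intros U HU. apply in_map_iff in HU. destruct HU as [c [<- _]]. apply open_ball. }
  { intro x. destruct (Hlc x) as [c [Hc Hx]].
    exists (fun y => mdist X c y < eps / 2). split; [|exact Hx].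
    apply in_map_iff. exists c. auto. }
  pose (V := fun a => nth a l (empty_set X)).
  (* The doubled radius leaves room: a point within the single radius of the centre still has a ball
     of that radius inside the member. *)
  pose (good := fun (t : X * R * nat) => 0 < snd (fst t) /\ (snd t < length l)%nat /\
     forall y, mdist X (fst (fst t)) y < 2 * snd (fst t) -> V (snd t) y).
  destruct (cpt {t | good t} (fun t y => mdist X (fst (fst (proj1_sig t))) y < snd (fst (proj1_sig t))))
    as [lt Hlt].
  { intro t. apply open_ball. }
  { intro x. destruct (lcov x) as [U [HU Ux]].
    destruct (In_nth _ _ (empty_set X) HU) as [a [al Ha]].
    destruct (lo U HU x Ux) as [r [r0 Hr]].
    assert (g : good (x, r / 2, a)).
    { split; [simpl; lra|]. split; [exact al|]. simpl. intros y Hy. unfold V. rewrite Ha.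
      apply Hr. lra. }
    exists (exist _ _ g). simpl. rewrite mdist_refl. lra. }
  assert (exists lam, 0 < lam /\ forall t, In t lt -> lam <= snd (fst (proj1_sig t))) as [lam [lam0 Hlam]].
  { clear Hlt. induction lt as [|t lt [lam [lam0 IH]]]; [exists 1; split; [lra|intros t []]|].
    exists (Rmin lam (snd (fst (proj1_sig t)))).
    split; [apply Rmin_glb_lt; [exact lam0|apply (proj2_sig t)]|].
    intros t' [<-|Ht']; simpl; [apply Rmin_r|].
    apply Rle_trans with (1 := Rmin_l _ _). apply IH, Ht'. }
  assert (leb : forall y, exists a, (a < length l)%nat /\ forall z, mdist X y z < lam -> V a z).
  { intro y. destruct (Hlt y) as [t [Ht Hy]]. pose proof (Hlam t Ht) as L.
    destruct t as [t [g0 [g1 g2]]]. simpl in *. exists (snd t). split; [exact g1|].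
    intros z Hz. apply g2. pose proof (mdist_tri X (fst (fst t)) y z). lra. }
  pose (lab := fun y => proj1_sig (constructive_indefinite_description _ (leb y))).
  assert (Hlab : forall y, (lab y < length l)%nat /\ forall z, mdist X y z < lam -> V (lab y) z).
  { intro y. unfold lab. apply (proj2_sig (constructive_indefinite_description _ (leb y))). }
  exists (length l), lab, lam. split; [exact lam0|]. split; [intro y; apply Hlab|]. split.
  - intros y y' E.
    assert (A : V (lab y) y) by (apply Hlab; rewrite mdist_refl; exact lam0).
    assert (A' : V (lab y) y') by (rewrite E; apply Hlab; rewrite mdist_refl; exact lam0).
    destruct (lref (V (lab y))) as [U [HU sub]]; [apply nth_In, Hlab|].
    apply in_map_iff in HU. destruct HU as [c [<- _]].
    apply sub in A. apply sub in A'. pose proof (mdist_tri X y c y').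
    rewrite (mdist_sym X y c) in *. lra.
  - intros y1 y2 y3 d2 d3. apply NNPP. intro N.
    assert (length (lab y1 :: lab y2 :: lab y3 :: nil) <= 2)%nat; [|simpl in *; lia].
    apply (lord y1).
    + repeat constructor; simpl; intuition congruence.
    + intros i [<-|[<-|[<-|[]]]]; (split; [apply Hlab|]); apply Hlab.
      * rewrite mdist_refl; exact lam0.
      * rewrite mdist_sym; exact d2.
      * rewrite mdist_sym; exact d3.
Qed.

Lemma idx_lower_bound (n : nat) (g : Idx n -> R) : (forall j, 0 < g j) ->
  exists m, 0 < m /\ forall j, m <= g j.
Proof.
  intro g0.
  assert (F : forall k, exists m, 0 < m /\ forall j, (proj1_sig j < k)%nat -> m <= g j).
  { induction k as [|k [m [m0 IH]]]; [exists 1; split; [lra|intros; lia]|].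
    destruct (le_lt_dec n k) as [nk|kn].
    - exists m. split; [exact m0|]. intros j _. apply IH. pose proof (proj2_sig j) as L; simpl in L; lia.
    - pose (i := exist (fun i => (i < n)%nat) k kn : Idx n). exists (Rmin m (g i)).
      split; [apply Rmin_glb_lt; auto|]. intros j Hj.
      destruct (Nat.eq_dec (proj1_sig j) k) as [E|ne].
      + replace j with i by (apply idx_eq; symmetry; exact E). apply Rmin_r.
      + apply Rle_trans with (1 := Rmin_l _ _). apply IH. lia. }
  destruct (F n) as [m [m0 H]]. exists m. split; [exact m0|]. intro j. apply H, (proj2_sig j).
Qed.

Lemma idx_upper_bound (n : nat) (g : Idx n -> nat) : exists m, forall j, (g j <= m)%nat.
Proof.
  assert (F : forall k, exists m, forall j, (proj1_sig j < k)%nat -> (g j <= m)%nat).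
  { induction k as [|k [m IH]]; [exists 0%nat; intros; lia|].
    destruct (le_lt_dec n k) as [nk|kn].
    - exists m. intros j _. apply IH. pose proof (proj2_sig j) as L; simpl in L; lia.
    - pose (i := exist (fun i => (i < n)%nat) k kn : Idx n). exists (max m (g i)). intros j Hj.
      destruct (Nat.eq_dec (proj1_sig j) k) as [E|ne].
      + replace j with i by (apply idx_eq; symmetry; exact E). lia.
      + specialize (IH j). lia. }
  destruct (F n) as [m H]. exists m. intro j. apply H, (proj2_sig j).
Qed.

(** * Grid points on the circles and closeness modulo [M] *)

Definition ang (M t : nat) : R := 2 * PI * INR t / INR M.

Lemma sin_small s kappa : 0 < kappa <= 1 / 2 -> 0 <= s <= 1 ->
  sin (PI * s) * sin (PI * s) < sin (PI * kappa) * sin (PI * kappa) -> s < kappa \/ 1 - kappa < s.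
Proof.
  intros Hk Hs H. apply NNPP. intro N.
  assert (C : kappa <= s <= 1 - kappa) by lra. pose proof PI_RGT_0 as P.
  assert (mono : forall t, kappa <= t <= 1 / 2 -> sin (PI * kappa) <= sin (PI * t)).
  { intros t Ht. apply sin_incr_1; nra. }
  assert (k0 : 0 <= sin (PI * kappa)) by (apply sin_ge_0; nra).
  assert (sin (PI * kappa) <= sin (PI * s)); [|nra].
  destruct (Rle_lt_dec s (1 / 2)) as [D|D]; [apply mono; lra|].
  replace (sin (PI * s)) with (sin (PI * (1 - s))); [apply mono; lra|].
  replace (PI * (1 - s)) with (PI - PI * s) by ring. apply sin_PI_x.
Qed.

Definition coordZ (p : nat * nat) (e : nat) : Z := if Nat.eqb (fst p) e then Z.of_nat (snd p) else 0%Z.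

(** The factor [8 * n] is a budget: after summing n coordinates the error stays below [M / 8], and
    two such errors plus one grid step stay below half the modulus. *)
Definition smallZ (M n : nat) (z : Z) : Prop :=
  exists g, (Z.divide (Z.of_nat M) (z - g) /\ 8 * Z.of_nat n * Z.abs g < Z.of_nat M)%Z.

Lemma smallZ_of_ratio M n (z : Z) (kappa : R) : (0 < M)%nat -> 0 < kappa -> 8 * INR n * kappa < 1 ->
  (Z.abs z <= Z.of_nat M)%Z ->
  (Rabs (IZR z / INR M) < kappa \/ 1 - kappa < Rabs (IZR z / INR M)) -> smallZ M n z.
Proof.
  intros M0 k0 kn zM H.
  assert (MR : 0 < INR M) by (apply lt_0_INR; exact M0).
  assert (key : forall g, Rabs (IZR g) < kappa * INR M -> (8 * Z.of_nat n * Z.abs g < Z.of_nat M)%Z).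
  { intros g Hg. apply lt_IZR. rewrite !mult_IZR, <- !INR_IZR_INZ, abs_IZR.
    pose proof (pos_INR n). apply Rle_lt_trans with (8 * INR n * (kappa * INR M)); [nra|].
    replace (8 * INR n * (kappa * INR M)) with ((8 * INR n * kappa) * INR M) by ring. nra. }
  assert (A : Rabs (IZR z / INR M) * INR M = Rabs (IZR z)).
  { unfold Rdiv. rewrite Rabs_mult, (Rabs_pos_eq (/ INR M)).
    - field. lra.
    - left. apply Rinv_0_lt_compat, MR. }
  destruct H as [H|H].
  - exists z. split; [exists 0%Z; lia|]. apply key. nra.
  - assert (B : (1 - kappa) * INR M < Rabs (IZR z)) by nra.
    assert (zMR : Rabs (IZR z) <= INR M).
    { rewrite <- abs_IZR, INR_IZR_INZ. apply IZR_le, zM. }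
    destruct (Z_le_gt_dec 0 z) as [C|C].
    + exists (z - Z.of_nat M)%Z. split; [exists 1%Z; lia|]. apply key.
      rewrite minus_IZR, <- INR_IZR_INZ. apply IZR_le in C.
      rewrite Rabs_pos_eq in B, zMR by exact C. apply Rabs_def1; nra.
    + exists (z + Z.of_nat M)%Z. split; [exists (-1)%Z; lia|]. apply key.
      rewrite plus_IZR, <- INR_IZR_INZ. assert (C' : IZR z < 0) by (apply IZR_lt; lia).
      rewrite Rabs_left in B, zMR by exact C'. apply Rabs_def1; nra.
Qed.

Lemma sin_sqr_abs x : sin (Rabs x) * sin (Rabs x) = sin x * sin x.
Proof. unfold Rabs. destruct (Rcase_abs x); [rewrite sin_neg; ring|reflexivity]. Qed.

Lemma circle_pt_bound n k u : 0 <= fst (circle_pt n k u) <= 2 * INR (n + 1) /\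
  - (2 * INR (n + 1)) <= snd (circle_pt n k u) <= 2 * INR (n + 1).
Proof.
  pose proof (radius_ge1 n k). pose proof (radius_le n k).
  pose proof (COS_bound u). pose proof (SIN_bound u).
  unfold circle_pt; simpl. split; nra.
Qed.

Lemma abs_le_of_sqr d r b : 0 <= b -> b * b = d ^ 2 + r ^ 2 -> - b <= d <= b.
Proof. intros b0 H. split; nra. Qed.

Lemma prod_abs_le d s b c : 0 <= b -> 0 <= c -> - b <= d <= b -> - c <= s <= c -> - (c * b) <= d * s <= c * b.
Proof. intros b0 c0 Hd Hs. split; nra. Qed.

(* On two distinct circles x^2 + y^2 = 2 K x the abscissa is controlled by the distance, since 2 (K - K') x is
   a difference of squared norms up to an error of that order. *)
Lemma distinct_circles_near_origin n k k' u u' : (k <= n)%nat -> (k' <= n)%nat -> k <> k' ->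
  2 * (sin (u / 2) * sin (u / 2)) <= 5 * INR (n + 1) * bdist n (bpt n k u) (bpt n k' u').
Proof.
  intros kn kn' ne. pose proof (circle_pt_bound n k u) as [Bx By].
  pose proof (circle_pt_bound n k' u') as [Bx' By'].
  pose proof (bdist_sqr n (bpt n k u) (bpt n k' u')) as E. simpl proj1_sig in E.
  pose proof (bdist_pos n (bpt n k u) (bpt n k' u')) as P.
  pose proof (radius_le n k') as L'. pose proof (radius_ge1 n k') as G'. pose proof (radius_ge1 n k) as G.
  assert (Q : fst (circle_pt n k u) * fst (circle_pt n k u) + snd (circle_pt n k u) * snd (circle_pt n k u)
    = 2 * radius n k * fst (circle_pt n k u)).
  { unfold circle_pt; simpl. pose proof (sin2_cos2 u) as H; unfold Rsqr in H. nra. }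
  assert (Q' : fst (circle_pt n k' u') * fst (circle_pt n k' u') + snd (circle_pt n k' u') * snd (circle_pt n k' u')
    = 2 * radius n k' * fst (circle_pt n k' u')).
  { unfold circle_pt; simpl. pose proof (sin2_cos2 u') as H; unfold Rsqr in H. nra. }
  assert (X : 2 * (sin (u / 2) * sin (u / 2)) <= fst (circle_pt n k u)).
  { unfold circle_pt; simpl. rewrite <- one_minus_cos. pose proof (COS_bound u). nra. }
  assert (D : radius n k <= radius n k' - 1 \/ radius n k' + 1 <= radius n k).
  { unfold radius. rewrite !Nat.min_l by lia. rewrite !plus_INR.
    destruct (lt_dec k k') as [C|C]; [left|right].
    - assert (INR (S k) <= INR k') by (apply le_INR; lia). rewrite S_INR in *. lra.
    - assert (INR (S k') <= INR k) by (apply le_INR; lia). rewrite S_INR in *. lra. }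
  apply Rle_trans with (1 := X). clear X.
  set (b := bdist _ _ _) in *. set (N := INR (n + 1)) in *. set (K := radius n k) in *.
  set (K' := radius n k') in *. set (x := fst (circle_pt n k u)) in *. set (y := snd (circle_pt n k u)) in *.
  set (x' := fst (circle_pt n k' u')) in *. set (y' := snd (circle_pt n k' u')) in *.
  assert (N1 : 1 <= N) by lra.
  assert (dx : - b <= x - x' <= b) by (apply (abs_le_of_sqr _ (y - y')); assumption).
  assert (dy : - b <= y - y' <= b) by (apply (abs_le_of_sqr _ (x - x')); lra).
  assert (H1 : - (8 * N * b) <= 2 * K * x - 2 * K' * x' <= 8 * N * b).
  { assert (- (4 * N * b) <= (x - x') * (x + x') <= 4 * N * b) by (apply prod_abs_le; lra).
    assert (- (4 * N * b) <= (y - y') * (y + y') <= 4 * N * b) by (apply prod_abs_le; lra).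
    rewrite <- Q, <- Q'. lra. }
  assert (H2 : - (2 * N * b) <= (x' - x) * (2 * K') <= 2 * N * b) by (apply prod_abs_le; lra).
  assert (H3 : - (10 * N * b) <= 2 * (K - K') * x <= 10 * N * b) by lra.
  destruct D as [D|D]; nra.
Qed.

(** On one circle the chord controls the angle difference up to full turns. On two different circles
    both points must be near the origin, so each coordinate is separately small modulo [M]. *)
Lemma grid_close_small n : (1 <= n)%nat -> exists eps, 0 < eps /\
  forall M k k' t t', (0 < M)%nat -> (k <= n)%nat -> (k' <= n)%nat -> (t < M)%nat -> (t' < M)%nat ->
  bdist n (bpt n k (ang M t)) (bpt n k' (ang M t')) < eps ->
  forall e, smallZ M n (coordZ (k, t) e - coordZ (k', t') e).
Proof.
  intro n1. assert (nR : 1 <= INR n) by (apply (le_INR 1); exact n1).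
  set (kappa := / (8 * INR n + 1)).
  assert (k0 : 0 < kappa) by (apply Rinv_0_lt_compat; lra).
  assert (kE : kappa * (8 * INR n + 1) = 1) by (unfold kappa; field; lra).
  assert (k2 : kappa <= 1 / 2) by nra. assert (k8 : 8 * INR n * kappa < 1) by nra.
  set (sg := sin (PI * kappa) * sin (PI * kappa)). pose proof PI_RGT_0 as P0.
  assert (sg0 : 0 < sg).
  { assert (0 < sin (PI * kappa)) by (apply sin_gt_0; nra). unfold sg; nra. }
  assert (sg1 : sg <= 1) by (pose proof (SIN_bound (PI * kappa)); unfold sg; nra).
  assert (N1 : 1 <= INR (n + 1)) by (rewrite plus_INR; simpl; lra).
  assert (near : forall M z, (0 < M)%nat -> (Z.abs z <= Z.of_nat M)%Z ->
    sin (PI * (IZR z / INR M)) * sin (PI * (IZR z / INR M)) < sg -> smallZ M n z).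
  { intros M z M0 zM H. apply smallZ_of_ratio with (kappa := kappa); auto.
    assert (MR : 0 < INR M) by (apply lt_0_INR; exact M0).
    apply sin_small; [lra| |].
    - split; [apply Rabs_pos|]. unfold Rdiv. rewrite Rabs_mult, (Rabs_pos_eq (/ INR M)).
      + apply Rmult_le_reg_r with (INR M); [exact MR|].
        replace (Rabs (IZR z) * / INR M * INR M) with (Rabs (IZR z)) by (field; lra).
        rewrite <- abs_IZR, Rmult_1_l, INR_IZR_INZ. apply IZR_le, zM.
      + left. apply Rinv_0_lt_compat, MR.
    - replace (PI * Rabs (IZR z / INR M)) with (Rabs (PI * (IZR z / INR M))).
      + rewrite sin_sqr_abs. exact H.
      + rewrite Rabs_mult, (Rabs_pos_eq PI) by lra. reflexivity. }
  (* [sg] is the squared sine below which an angle is within [kappa] turns of zero; the denominator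
     absorbs the constant [5 * INR (n + 1)] of [distinct_circles_near_origin]. *)
  exists (sg / (10 * INR (n + 1))). split; [apply Rdiv_lt_0_compat; lra|].
  intros M k k' t t' M0 kn kn' tM tM' H e.
  assert (MR : 0 < INR M) by (apply lt_0_INR; exact M0).
  assert (H' : 10 * INR (n + 1) * bdist n (bpt n k (ang M t)) (bpt n k' (ang M t')) < sg).
  { apply Rmult_lt_compat_l with (r := 10 * INR (n + 1)) in H; [|lra].
    replace (10 * INR (n + 1) * (sg / (10 * INR (n + 1)))) with sg in H by (field; lra). exact H. }
  assert (zero : smallZ M n 0) by (exists 0%Z; split; [exists 0%Z; lia|simpl; lia]).
  unfold coordZ; simpl fst; simpl snd.
  destruct (Nat.eq_dec k k') as [<-|ne].
  - destruct (Nat.eqb k e); [|exact zero].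
    apply near; [exact M0|lia|].
    pose proof (bpt_dist n k (ang M t) (ang M t')) as E.
    replace ((ang M t - ang M t') / 2) with (PI * (IZR (Z.of_nat t - Z.of_nat t') / INR M)) in E.
    2: { unfold ang. rewrite minus_IZR, <- !INR_IZR_INZ. field. lra. }
    set (v := sin (PI * (IZR (Z.of_nat t - Z.of_nat t') / INR M))) in *. set (w := v * v) in *.
    pose proof (radius_ge1 n k). pose proof (bdist_pos n (bpt n k (ang M t)) (bpt n k (ang M t'))).
    set (b := bdist _ _ _) in *. assert (b < 1) by nra.
    assert (0 <= w) by apply Rle_0_sqr.
    assert (rr : 1 <= radius n k * radius n k) by nra.
    set (q := radius n k * radius n k) in *.
    assert (w <= b * b) by (rewrite E; nra). nra.
  - assert (A : smallZ M n (Z.of_nat t)).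
    { apply near; [exact M0|lia|]. rewrite <- INR_IZR_INZ.
      replace (PI * (INR t / INR M)) with (ang M t / 2) by (unfold ang; field; lra).
      pose proof (distinct_circles_near_origin n k k' (ang M t) (ang M t') kn kn' ne).
      pose proof (bdist_pos n (bpt n k (ang M t)) (bpt n k' (ang M t'))). nra. }
    assert (A' : smallZ M n (- Z.of_nat t')).
    { apply near; [exact M0|lia|]. rewrite opp_IZR, <- INR_IZR_INZ.
      replace (PI * (- INR t' / INR M)) with (- (ang M t' / 2)) by (unfold ang; field; lra).
      rewrite sin_neg.
      pose proof (distinct_circles_near_origin n k' k (ang M t') (ang M t) kn' kn (not_eq_sym ne)) as B.
      rewrite bdist_sym in B.
      pose proof (bdist_pos n (bpt n k (ang M t)) (bpt n k' (ang M t'))). nra. }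
    destruct (Nat.eqb k e) eqn:E1, (Nat.eqb k' e) eqn:E2.
    + apply Nat.eqb_eq in E1, E2. congruence.
    + replace (Z.of_nat t - 0)%Z with (Z.of_nat t) by lia. exact A.
    + exact A'.
    + exact zero.
Qed.

(** * Transfer of the labels to tuples of grid points *)

Definition grid_near (M t t' : nat) : Prop :=
  t' = t \/ t' = ((t + 1) mod M)%nat \/ t = ((t' + 1) mod M)%nat.

Lemma bpt_ang_mod n k M t : (t < M)%nat ->
  bpt n k (ang M ((t + 1) mod M)) = bpt n k (ang M (t + 1)).
Proof.
  intro tM. destruct (Nat.eq_dec (t + 1) M) as [E|ne].
  - rewrite E, Nat.Div0.mod_same. apply bouquet_eq. simpl. unfold circle_pt, ang.
    assert (INR M <> 0) by (apply not_0_INR; lia).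
    replace (2 * PI * INR M / INR M) with (2 * PI) by (field; assumption).
    replace (2 * PI * INR 0 / INR M) with 0 by (simpl; field; assumption).
    rewrite cos_2PI, sin_2PI, cos_0, sin_0. reflexivity.
  - rewrite Nat.mod_small by lia. reflexivity.
Qed.

Lemma bpt_near n k M t t' : (t < M)%nat -> (t' < M)%nat -> grid_near M t t' ->
  bdist n (bpt n k (ang M t)) (bpt n k (ang M t')) <= INR (n + 1) * (2 * PI / INR M).
Proof.
  intros tM tM' H. assert (MR : 0 < INR M) by (apply lt_0_INR; lia). pose proof PI_RGT_0.
  assert (step : forall a, (a < M)%nat ->
    bdist n (bpt n k (ang M a)) (bpt n k (ang M ((a + 1) mod M))) <= INR (n + 1) * (2 * PI / INR M)).
  { intros a aM. rewrite bpt_ang_mod by exact aM.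
    apply Rle_trans with (1 := bpt_lip _ _ _ _). apply Rmult_le_compat_l; [apply pos_INR|].
    replace (ang M a - ang M (a + 1)) with (- (2 * PI / INR M)).
    - rewrite Rabs_Ropp, Rabs_pos_eq; [lra|]. left. apply Rdiv_lt_0_compat; lra.
    - unfold ang. rewrite plus_INR. simpl. field. lra. }
  destruct H as [->|[->|E]].
  - assert (E := bpt_dist n k (ang M t) (ang M t)).
    replace ((ang M t - ang M t) / 2) with 0 in E by field. rewrite sin_0 in E.
    pose proof (bdist_pos n (bpt n k (ang M t)) (bpt n k (ang M t))).
    assert (0 <= INR (n + 1) * (2 * PI / INR M)).
    { apply Rmult_le_pos; [apply pos_INR|]. left. apply Rdiv_lt_0_compat; lra. }
    nra.
  - apply step, tM.
  - rewrite E at 1. rewrite bdist_sym. apply step, tM'.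
Qed.

Definition valid_pt n (M : nat) (x : Idx n -> nat * nat) : Prop :=
  forall a, (fst (x a) <= n)%nat /\ (snd (x a) < M)%nat.

Definition pt_near n (M : nat) (x y : Idx n -> nat * nat) : Prop :=
  forall a, fst (y a) = fst (x a) /\ grid_near M (snd (x a)) (snd (y a)).

(** All the topology that the combinatorial part receives. The last clause is quantitative
    injectivity on the symmetric product; its neighbour [z] may depend on [j], since distances are
    compared one factor at a time. The modulus is even so that parity tells vertices from edges, and
    at least 4 to leave room for rounding. *)
Theorem embedding_grid_labelling n (Y : Idx n -> MSpace) f : (1 <= n)%nat ->
  (forall j, curve (Y j)) -> SP_embedding n Y f ->
  exists (h N : nat) (lab : Idx n -> (Idx n -> nat * nat) -> nat), let M := (4 + 2 * h)%nat in
  (forall j x, (lab j x < N)%nat) /\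
  (forall j x y, (forall a, x a = y a \/ (snd (x a) = 0%nat /\ snd (y a) = 0%nat)) -> lab j x = lab j y) /\
  (forall j x s, is_perm n s -> lab j (fun a => x (s a)) = lab j x) /\
  (forall j x y1 y2 y3, valid_pt n M x -> valid_pt n M y1 -> valid_pt n M y2 -> valid_pt n M y3 ->
     pt_near n M x y1 -> pt_near n M x y2 -> pt_near n M x y3 ->
     lab j y1 = lab j y2 \/ lab j y2 = lab j y3 \/ lab j y3 = lab j y1) /\
  (forall x y, valid_pt n M x -> valid_pt n M y ->
     (forall j, exists z, valid_pt n M z /\ pt_near n M y z /\ lab j z = lab j x) ->
     exists s, is_perm n s /\ forall a e, smallZ M n (coordZ (x a) e - coordZ (y (s a)) e)).
Proof.
  intros n1 Hc emb.
  destruct (grid_close_small n n1) as [eps [eps0 Heps]].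
  destruct (embedding_unif_inv n Y f emb eps eps0) as [d [d0 Hd]].
  pose proof (fun j => match Hc j with conj cp (conj _ (conj dm _)) =>
    curve_labelling (Y j) (d / 2) cp dm ltac:(lra) end) as C.
  destruct (constructive_indefinite_description (fun T : (forall j : Idx n, nat * (Y j -> nat) * R) =>
    forall j, 0 < snd (T j) /\ (forall y, (snd (fst (T j)) y < fst (fst (T j)))%nat) /\
    (forall y y', snd (fst (T j)) y = snd (fst (T j)) y' -> mdist (Y j) y y' < d / 2) /\
    (forall y1 y2 y3, mdist (Y j) y1 y2 < snd (T j) -> mdist (Y j) y1 y3 < snd (T j) ->
     snd (fst (T j)) y1 = snd (fst (T j)) y2 \/ snd (fst (T j)) y2 = snd (fst (T j)) y3 \/
     snd (fst (T j)) y3 = snd (fst (T j)) y1))) as [T HT].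
  { assert (C' : forall j, exists t : nat * (Y j -> nat) * R,
      0 < snd t /\ (forall y, (snd (fst t) y < fst (fst t))%nat) /\
      (forall y y', snd (fst t) y = snd (fst t) y' -> mdist (Y j) y y' < d / 2) /\
      (forall y1 y2 y3, mdist (Y j) y1 y2 < snd t -> mdist (Y j) y1 y3 < snd t ->
       snd (fst t) y1 = snd (fst t) y2 \/ snd (fst t) y2 = snd (fst t) y3 \/
       snd (fst t) y3 = snd (fst t) y1)).
    { intro j. destruct (C j) as [N [lab [lam H]]]. exists (N, lab, lam). exact H. }
    exists (fun j => proj1_sig (constructive_indefinite_description _ (C' j))).
    intro j. exact (proj2_sig (constructive_indefinite_description _ (C' j))). }
  clear C.
  destruct (idx_lower_bound n (fun j => snd (T j))) as [lam [lam0 Hlam]]; [intro j; apply HT|].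
  destruct (idx_upper_bound n (fun j => fst (fst (T j)))) as [N HN].
  (* [lam / 2] puts two neighbours of one grid point within [lam] of each other; [d / 2] adds up
     with the mesh [d / 2] of the labels to the [d] of the inverse. *)
  destruct (embedding_unif_cont n Y f emb (Rmin (lam / 2) (d / 2))) as [eta [eta0 Heta]].
  { apply Rmin_glb_lt; lra. }
  pose proof (Rmin_l (lam / 2) (d / 2)) as Rl. pose proof (Rmin_r (lam / 2) (d / 2)) as Rr.
  destruct (INR_unbounded (INR (n + 1) * (2 * PI) / eta)) as [h Hh].
  set (M := (4 + 2 * h)%nat).
  assert (M0 : (0 < M)%nat) by (unfold M; lia).
  assert (MR : 0 < INR M) by (apply lt_0_INR; exact M0).
  assert (hM : INR h <= INR M) by (apply le_INR; unfold M; lia).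
  assert (small_step : INR (n + 1) * (2 * PI / INR M) < eta).
  { apply Rmult_lt_reg_r with (INR M); [exact MR|].
    replace (INR (n + 1) * (2 * PI / INR M) * INR M) with (INR (n + 1) * (2 * PI)) by (field; lra).
    assert (H : INR (n + 1) * (2 * PI) / eta < INR M) by lra.
    apply Rmult_lt_compat_l with (r := eta) in H; [|exact eta0].
    replace (eta * (INR (n + 1) * (2 * PI) / eta)) with (INR (n + 1) * (2 * PI)) in H by (field; lra).
    exact H. }
  pose (pt := fun (x : Idx n -> nat * nat) (a : Idx n) => bpt n (fst (x a)) (ang M (snd (x a)))).
  assert (ptg : forall x, valid_pt n M x -> forall a, on_circles n (pt x a)).
  { intros x Hx a. destruct (Hx a) as [H1 H2]. exists (fst (x a)), (ang M (snd (x a))).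
    split; [exact H1|]. split; [|reflexivity]. unfold ang. pose proof PI_RGT_0 as P0.
    assert (INR (snd (x a)) <= INR M) by (apply le_INR; lia). pose proof (pos_INR (snd (x a))).
    split.
    - apply Rmult_le_pos; [nra|left; apply Rinv_0_lt_compat, MR].
    - apply Rmult_le_reg_r with (INR M); [exact MR|].
      replace (2 * PI * INR (snd (x a)) / INR M * INR M) with (2 * PI * INR (snd (x a))) by (field; lra). nra. }
  assert (nearf : forall x y, valid_pt n M x -> valid_pt n M y -> pt_near n M x y ->
    forall j, mdist (Y j) (f (pt x) j) (f (pt y) j) < Rmin (lam / 2) (d / 2)).
  { intros x y Hx Hy Hn. apply Heta; [apply ptg, Hx|]. intro i. unfold pt.
    destruct (Hn i) as [E G]. rewrite E. apply Rle_lt_trans with (2 := small_step).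
    apply bpt_near; [apply Hx|apply Hy|exact G]. }
  exists h, (S N), (fun j x => snd (fst (T j)) (f (pt x) j)). cbv beta zeta. fold M.
  split; [|split; [|split; [|split]]].
  - intros j x. destruct (HT j) as [_ [H _]]. specialize (H (f (pt x) j)). specialize (HN j). lia.
  - intros j x y H. f_equal. f_equal. apply functional_extensionality. intro a. unfold pt.
    destruct (H a) as [->|[E1 E2]]; [reflexivity|]. rewrite E1, E2.
    assert (A0 : ang M 0 = 0) by (unfold ang; change (INR 0) with 0; field; lra).
    rewrite A0. apply bouquet_eq. simpl proj1_sig. unfold circle_pt. rewrite cos_0, sin_0. f_equal; ring.
  - intros j x s ps. destruct emb as [sym _].
    change (pt (fun a => x (s a))) with (fun a => pt x (s a)). rewrite sym by exact ps. reflexivity.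
  - intros j x y1 y2 y3 Hx H1 H2 H3 N1 N2 N3. destruct (HT j) as [_ [_ [_ H]]].
    specialize (Hlam j). simpl in Hlam.
    pose proof (nearf x y1 Hx H1 N1 j). pose proof (nearf x y2 Hx H2 N2 j). pose proof (nearf x y3 Hx H3 N3 j).
    apply H.
    + pose proof (mdist_tri (Y j) (f (pt y1) j) (f (pt x) j) (f (pt y2) j)).
      rewrite (mdist_sym (Y j) (f (pt y1) j) (f (pt x) j)) in *. lra.
    + pose proof (mdist_tri (Y j) (f (pt y1) j) (f (pt x) j) (f (pt y3) j)).
      rewrite (mdist_sym (Y j) (f (pt y1) j) (f (pt x) j)) in *. lra.
  - intros x y Hx Hy Hz. destruct (Hd (pt x) (pt y) (ptg x Hx)) as [s [ps Hs]].
    { intro j. destruct (Hz j) as [z [Vz [Nz Ez]]]. destruct (HT j) as [_ [_ [H _]]].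
      pose proof (H _ _ Ez). pose proof (nearf y z Hy Vz Nz j).
      pose proof (mdist_tri (Y j) (f (pt x) j) (f (pt z) j) (f (pt y) j)).
      rewrite (mdist_sym (Y j) (f (pt x) j) (f (pt z) j)) in *.
      rewrite (mdist_sym (Y j) (f (pt y) j) (f (pt z) j)) in *. lra. }
    exists s. split; [exact ps|]. intros a e. specialize (Hs a). unfold pt in Hs.
    destruct (x a) as [k t] eqn:Ex, (y (s a)) as [k' t'] eqn:Ey.
    pose proof (Hx a) as V1. pose proof (Hy (s a)) as V2. rewrite Ex in V1. rewrite Ey in V2.
    simpl in *. apply Heps; tauto.
Qed.

(** The congruence is freed of subtraction and of signs, so that it can be cast from [nat] into
    ['Z_m.+2]. *)
Lemma smallZ_nat M n p p' e : smallZ M n (coordZ p e - coordZ p' e) ->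
  let c := if Nat.eqb (fst p) e then snd p else 0%nat in
  let c' := if Nat.eqb (fst p') e then snd p' else 0%nat in
  exists q u v, (8 * n * q < M)%nat /\
    ((c + M * u = c' + q + M * v)%nat \/ (c + q + M * u = c' + M * v)%nat).
Proof.
  intros [g [[w Hw] Hg]] c c'.
  assert (E : (Z.of_nat c - Z.of_nat c' - g = w * Z.of_nat M)%Z).
  { rewrite <- Hw. unfold coordZ, c, c'.
    destruct (Nat.eqb (fst p) e), (Nat.eqb (fst p') e); simpl; lia. }
  exists (Z.to_nat (Z.abs g)), (Z.to_nat (- w)), (Z.to_nat w).
  split; [apply Nat2Z.inj_lt; rewrite !Nat2Z.inj_mul, Z2Nat.id by lia; lia|].
  assert (Ew : w = (Z.of_nat (Z.to_nat w) - Z.of_nat (Z.to_nat (- w)))%Z) by lia.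
  assert (Eq : (Z.of_nat (Z.to_nat (Z.abs g)) = Z.abs g)%Z) by lia.
  set (u := Z.to_nat (- w)) in *. set (v := Z.to_nat w) in *. set (q := Z.to_nat (Z.abs g)) in *.
  destruct (Z_le_gt_dec 0 g); [left|right]; apply Nat2Z.inj;
    rewrite !Nat2Z.inj_add, !Nat2Z.inj_mul, Eq; rewrite Ew in E; lia.
Qed.

Module GridTorus.
From mathcomp Require Import all_boot all_order all_fingroup all_algebra.
From mathcomp Require Import ring lra zify.
Set Implicit Arguments. Unset Strict Implicit. Unset Printing Implicit Defensive.
Import GRing.Theory Num.Theory.
Local Open Scope ring_scope.

(** * Cup products of 1-cochains on a grid torus *)

Section Flags.
Variables (d m : nat).
Notation grid := {ffun 'I_d -> 'Z_m.+2}.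
(* With an even modulus m.+2, a point p of the grid stands for a face of the cubical torus of half the modulus:
   even coordinates are vertices, odd coordinates are edges. The flag (p, s, pi) with p a vertex is the maximal
   chain of faces that starts at p and, at step l, moves in direction s (pi l) along the coordinate pi l. *)
Definition flag := (grid * {ffun 'I_d -> bool} * 'S_d)%type.
Implicit Types (F : flag) (p q : grid) (K : flag -> rat).

Definition unit_vec (i : 'I_d) : grid := [ffun j => (j == i)%:R].
Definition unit_step (s : bool) : 'Z_m.+2 := if s then 1 else -1.
Definition vertex F (l : nat) : grid :=
  [ffun i => F.1.1 i + if ((F.2^-1)%g i < l)%N then unit_step (F.1.2 i) else 0].
Definition is_even_vertex (p : grid) := [forall i, ~~ odd (p i)].
(** The orientation of the simplex that the flag spans in the barycentric subdivision; [flag_sum] is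
    thus evaluation on the fundamental cycle of the torus. *)
Definition flag_sign F : rat := (-1) ^+ F.2 * \prod_i (-1) ^+ (~~ F.1.2 i).
Definition flag_sum K : rat := \sum_(F | is_even_vertex F.1.1) flag_sign F * K F.

Lemma gridDE p q i : (p + q) i = p i + q i.
Proof. by rewrite ffunE. Qed.

Lemma gridNE p i : (- p) i = - p i.
Proof. by rewrite ffunE. Qed.

Lemma unit_vecE i j : unit_vec i j = (j == i)%:R.
Proof. by rewrite ffunE. Qed.

Lemma vertexE F l i :
  vertex F l i = F.1.1 i + if ((F.2^-1)%g i < l)%N then unit_step (F.1.2 i) else 0.
Proof. by rewrite ffunE. Qed.

Lemma vertexS F (l : 'I_d) :
  vertex F l.+1 = if F.1.2 (F.2 l) then vertex F l + unit_vec (F.2 l) else vertex F l - unit_vec (F.2 l).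
Proof.
have E i : ((F.2^-1)%g i == l) = (i == F.2 l).
  by apply/eqP/eqP => [<-|->]; rewrite ?permKV ?permK.
apply/ffunP => i; rewrite vertexE ltnS leq_eqVlt.
have -> : (nat_of_ord ((F.2^-1)%g i) == l) = (i == F.2 l) by rewrite -E.
case: (eqVneq i (F.2 l)) => [->|ne] /=.
  by case: (F.1.2 (F.2 l)); rewrite gridDE ?gridNE vertexE unit_vecE permK ltnn eqxx addr0.
by case: (F.1.2 (F.2 l)); rewrite gridDE ?gridNE vertexE unit_vecE (negbTE ne) ?oppr0 addr0.
Qed.

Lemma flag_sum_invol (t : flag -> flag) K :
  involutive t -> (forall F, is_even_vertex (t F).1.1 = is_even_vertex F.1.1) ->
  (forall F, flag_sign (t F) = - flag_sign F) -> (forall F, K (t F) = K F) -> flag_sum K = 0.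
Proof.
move=> ti te ts tK.
have: flag_sum K = - flag_sum K.
  rewrite {1}/flag_sum (reindex_inj (inv_inj ti)) /= /flag_sum -sumrN.
  apply: eq_big => [F|F _]; first by rewrite te.
  by rewrite ts tK mulNr.
move/eqP; rewrite -subr_eq0 opprK -mulr2n -mulr_natl mulf_eq0 pnatr_eq0 /=.
by move/eqP.
Qed.

Definition flip (i : 'I_d) (s : {ffun 'I_d -> bool}) : {ffun 'I_d -> bool} :=
  [ffun j => s j (+) (j == i)].

Lemma flipK i : involutive (flip i).
Proof. by move=> s; apply/ffunP => j; rewrite !ffunE -addbA addbb addbF. Qed.

Lemma flip_sgn i s : \prod_j (-1) ^+ (~~ flip i s j) = - \prod_j (-1) ^+ (~~ s j) :> rat.
Proof.
rewrite (bigD1 i) //= [in RHS](bigD1 i) //= ffunE eqxx addbT -mulNr.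
congr (_ * _); first by case: (s i); rewrite /= ?expr0 ?expr1 ?opprK.
by apply: eq_bigr => j ne; rewrite ffunE (negbTE ne) addbF.
Qed.

(** Sign-reversing involutions that express that the fundamental chain is a cycle. Swapping
    consecutive steps alters one inner vertex, [last_flag] at the last step alters the end, and
    [first_flag] at the first step alters the start, which moves by two units and so stays even. *)
Definition swap_flag (k l : 'I_d) F : flag := (F.1, (tperm k l * F.2)%g).
Definition last_flag (k : 'I_d) F : flag := (F.1.1, flip (F.2 k) F.1.2, F.2).
Definition first_flag (k : 'I_d) F : flag :=
  (F.1.1 + [ffun j => if j == F.2 k then unit_step (F.1.2 j) + unit_step (F.1.2 j) else 0],
   flip (F.2 k) F.1.2, F.2).

Lemma swap_flag_vertex (k l : 'I_d) F n : l = k.+1 :> nat -> n != l :> nat ->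
  vertex (swap_flag k l F) n = vertex F n.
Proof.
move=> lk nl; apply/ffunP => i; rewrite !vertexE /= invMg tpermV permM.
set a := ((F.2^-1)%g i).
suff -> : (tperm k l a < n)%N = (a < n)%N by [].
by case: tpermP => [->|->|//]; move: lk nl => /eqP; lia.
Qed.

Lemma last_flag_vertex (k : 'I_d) F n : (n <= k)%N -> vertex (last_flag k F) n = vertex F n.
Proof.
move=> nk; apply/ffunP => i; rewrite !vertexE /= !ffunE.
case: (eqVneq i (F.2 k)) => [->|ne]; last by rewrite addbF.
by rewrite permK ltnNge nk.
Qed.

Lemma first_flag_vertex (k : 'I_d) F n : (k < n)%N -> vertex (first_flag k F) n = vertex F n.
Proof.
move=> nk; apply/ffunP => i; rewrite !vertexE /= !ffunE.
case: (eqVneq i (F.2 k)) => [->|ne]; last by rewrite addbF addr0.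
rewrite permK nk addbT -addrA; congr (_ + _).
by case: (F.1.2 _); rewrite /unit_step ?addrK ?addrNK // addrK.
Qed.

Hypothesis m_even : ~~ odd m.

Lemma odd_unit_step (z : 'Z_m.+2) s : odd (z + unit_step s : 'Z_m.+2)%R = ~~ odd z.
Proof.
have m2 : odd m.+2 = false by rewrite /= negbK; apply: negbTE.
have o1 (x : nat) : odd (x %% m.+2) = odd x.
  by rewrite {2}(divn_eq x m.+2) oddD oddM m2 andbF.
have oD (x y : 'Z_m.+2) : odd (x + y : 'Z_m.+2)%R = odd x (+) odd y.
  by rewrite /= o1 oddD.
rewrite oD; case: s; rewrite /unit_step; first by rewrite addbT.
suff -> : odd (- 1 : 'Z_m.+2)%R by rewrite addbT.
have := oD (-1) 1; rewrite addNr /= => /esym/negbT.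
by rewrite -[X in X (+) _]negbK addNb negbK; case: (odd _).
Qed.

Lemma odd_add2 (z : 'Z_m.+2) s : odd (z + (unit_step s + unit_step s) : 'Z_m.+2)%R = odd z.
Proof. by rewrite addrA !odd_unit_step negbK. Qed.

Lemma swap_flag_sum (k l : 'I_d) K : l = k.+1 :> nat ->
  (forall F, K (swap_flag k l F) = K F) -> flag_sum K = 0.
Proof.
move=> lk; have kl : k != l by apply/eqP => E; move: lk; rewrite E; lia.
apply: flag_sum_invol => [[F s]|//|F]; first by rewrite /swap_flag /= mulgA tperm2 mul1g.
by rewrite /flag_sign /= odd_mul_tperm kl /= signrN mulNr.
Qed.

Lemma last_flag_sum (k : 'I_d) K :
  (forall F, K (last_flag k F) = K F) -> flag_sum K = 0.
Proof.
apply: flag_sum_invol => [[[p s] g]|//|F]; first by rewrite /last_flag /= flipK.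
by rewrite /flag_sign /= flip_sgn mulrN.
Qed.

Lemma first_flag_sum (k : 'I_d) K :
  (forall F, K (first_flag k F) = K F) -> flag_sum K = 0.
Proof.
apply: flag_sum_invol => [[[p s] g]|F|F].
- rewrite /first_flag /= flipK; congr (_, _, _).
  apply/ffunP => i; rewrite !ffunE -addrA.
  case: (eqVneq i (g k)) => [->|ne]; last by rewrite !addr0.
  rewrite addbT; suff -> : unit_step (s (g k)) + unit_step (s (g k)) +
    (unit_step (~~ s (g k)) + unit_step (~~ s (g k))) = 0.
    by rewrite addr0.
  by case: (s (g k)) => /=; ring.
- apply/forallP/forallP => H i; move: (H i) => /=; rewrite !ffunE; case: ifP => _;
  by rewrite ?odd_add2 ?addr0.
- by rewrite /flag_sign /= flip_sgn mulrN.
Qed.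

Definition step_vec (s : bool) (i : 'I_d) : grid := if s then unit_vec i else - unit_vec i.

Lemma vertexSd F (l : 'I_d) : vertex F l.+1 = vertex F l + step_vec (F.1.2 (F.2 l)) (F.2 l).
Proof. by rewrite vertexS /step_vec; case: ifP. Qed.

Implicit Types (b : grid -> grid -> rat).

Definition closed1 b :=
  (forall x y, b x y = - b y x) /\
  (forall x i j, b x (x + unit_vec i) + b (x + unit_vec i) (x + unit_vec i + unit_vec j) =
                 b x (x + unit_vec j) + b (x + unit_vec j) (x + unit_vec j + unit_vec i)).

Lemma closed1_dir b x s t i j : closed1 b ->
  b x (x + step_vec s i) + b (x + step_vec s i) (x + step_vec s i + step_vec t j) =
  b x (x + step_vec t j) + b (x + step_vec t j) (x + step_vec t j + step_vec s i).
Proof.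
move=> [anti sq].
pose P u v := forall x, b x (x + u) + b (x + u) (x + u + v) = b x (x + v) + b (x + v) (x + v + u).
(* The relation for [u] at [y - u], read from another corner; antisymmetry reverses the edges that
   are run through backwards. *)
have PN u v : P u v -> P (- u) v.
  move=> H y; have E : y - u + v + u = y + v by rewrite addrAC addrNK.
  have := H (y - u); rewrite E addrNK (addrAC y v) (anti y (y - u)) (anti (y + v)).
  lra.
have PC u v : P u v -> P v u by move=> H y; rewrite -H.
have P1 : P (unit_vec i) (unit_vec j) by move=> y; apply: sq.
have P2 : P (step_vec s i) (unit_vec j) by rewrite /step_vec; case: s => //; apply: PN.
suff: P (step_vec t j) (step_vec s i) by move/PC; apply.
have P3 : P (unit_vec j) (step_vec s i) by apply: PC.
by rewrite {1}/step_vec; case: t => //; apply: PN.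
Qed.

Definition edge_val b F (l : nat) := b (vertex F l) (vertex F l.+1).

Lemma closed1_swap b (k l : 'I_d) F : closed1 b -> l = k.+1 :> nat ->
  edge_val b (swap_flag k l F) k + edge_val b (swap_flag k l F) l = edge_val b F k + edge_val b F l.
Proof.
move=> cb lk; rewrite /edge_val -lk.
have E1 : vertex (swap_flag k l F) k = vertex F k by apply: swap_flag_vertex => //; rewrite lk; lia.
have E2 : vertex (swap_flag k l F) l = vertex F k + step_vec (F.1.2 (F.2 l)) (F.2 l).
  by rewrite lk vertexSd E1 /= permM tpermL.
have E3 : vertex (swap_flag k l F) l.+1 =
    vertex F k + step_vec (F.1.2 (F.2 l)) (F.2 l) + step_vec (F.1.2 (F.2 k)) (F.2 k).
  by rewrite vertexSd E2 /= permM tpermR.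
have E4 : vertex F l = vertex F k + step_vec (F.1.2 (F.2 k)) (F.2 k) by rewrite {1}lk vertexSd.
by rewrite E1 E2 E3 vertexSd E4 -closed1_dir.
Qed.

Lemma edge_val_ext b F F' l : vertex F l = vertex F' l -> vertex F l.+1 = vertex F' l.+1 ->
  edge_val b F l = edge_val b F' l.
Proof. by rewrite /edge_val => -> ->. Qed.

Lemma flag_sumB K K' : flag_sum (fun F => K F - K' F) = flag_sum K - flag_sum K'.
Proof. by rewrite /flag_sum -sumrB; apply: eq_bigr => F _; rewrite mulrBr. Qed.

Lemma eq_flag_sum K K' : (forall F, is_even_vertex F.1.1 -> K F = K' F) -> flag_sum K = flag_sum K'.
Proof. by move=> E; apply: eq_bigr => F e; rewrite E. Qed.

Definition upto (k : nat) K :=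
  forall F F', (forall l, (l <= k)%N -> vertex F l = vertex F' l) -> K F = K F'.
Definition from (k : nat) K :=
  forall F F', (forall l, (k <= l <= d)%N -> vertex F l = vertex F' l) -> K F = K F'.

(* Stokes' formula: K depends on the first vertices only, so step k carries no cochain. Closedness moves the free
   step to the end of the flag, where the terms cancel under flipping the last direction. *)
Lemma flag_sum_skip_r (bs : nat -> grid -> grid -> rat) (k : nat) K :
  (forall l, closed1 (bs l)) -> (k < d)%N -> upto k K ->
  flag_sum (fun F => K F * \prod_(k.+1 <= l < d) edge_val (bs l) F l) = 0.
Proof.
move=> cb; move E : (d - k)%N => c.
elim: c k K E => [|c IH] k K E kd uK; first by lia.
case: (ltnP k.+1 d) => kd1; last first.
  apply: (@last_flag_sum (Ordinal kd)) => F; rewrite !big_geq //; congr (_ * _).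
  by apply: uK => l lk; apply: last_flag_vertex.
have -> : flag_sum (fun F => K F * \prod_(k.+1 <= l < d) edge_val (bs l) F l) =
  flag_sum (fun F => K F * (edge_val (bs k.+1) F k + edge_val (bs k.+1) F k.+1) *
                 \prod_(k.+2 <= l < d) edge_val (bs l) F l) -
  flag_sum (fun F => K F * edge_val (bs k.+1) F k * \prod_(k.+2 <= l < d) edge_val (bs l) F l).
  rewrite -flag_sumB; apply: eq_flag_sum => F _; rewrite big_ltn //; ring.
rewrite [X in _ - X]IH ?subr0; first last.
- move=> F F' H; rewrite (uK F F') => [|l lk]; last by apply: H; lia.
  by congr (_ * _); apply: edge_val_ext; apply: H; lia.
- by [].
- by lia.
apply: (@swap_flag_sum (Ordinal kd) (Ordinal kd1)) => // F.
have S n : n != k.+1 -> vertex (swap_flag (Ordinal kd) (Ordinal kd1) F) n = vertex F n.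
  by move=> ne; apply: swap_flag_vertex.
congr (_ * _ * _).
- by apply: uK => l lk; apply: S; lia.
- exact: (closed1_swap F (cb k.+1) (erefl : Ordinal kd1 = (Ordinal kd).+1 :> nat)).
- by apply: eq_big_nat => l lk; apply: edge_val_ext; apply: S; lia.
Qed.

(** Mirror image of [flag_sum_skip_r]: the free step is moved to the start of the flag, where
    [first_flag] cancels the terms. *)
Lemma flag_sum_skip_l (bs : nat -> grid -> grid -> rat) (k : nat) K :
  (forall l, closed1 (bs l)) -> (k < d)%N -> from k.+1 K ->
  flag_sum (fun F => \prod_(0 <= l < k) edge_val (bs l) F l * K F) = 0.
Proof.
move=> cb; elim: k K => [|k IH] K kd uK.
  apply: (@first_flag_sum (Ordinal kd)) => F; rewrite !big_geq //; congr (_ * _).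
  by apply: uK => l lk; apply: first_flag_vertex; case/andP: lk.
have kd' : (k < d)%N by lia.
have -> : flag_sum (fun F => \prod_(0 <= l < k.+1) edge_val (bs l) F l * K F) =
  flag_sum (fun F => \prod_(0 <= l < k) edge_val (bs l) F l *
                 (edge_val (bs k) F k + edge_val (bs k) F k.+1) * K F) -
  flag_sum (fun F => \prod_(0 <= l < k) edge_val (bs l) F l * (edge_val (bs k) F k.+1 * K F)).
  rewrite -flag_sumB; apply: eq_flag_sum => F _; rewrite big_nat_recr //=; ring.
rewrite [X in _ - X]IH ?subr0; first last.
- move=> F F' H; rewrite (uK F F') => [|l lk]; last by apply: H; lia.
  by congr (_ * _); apply: edge_val_ext; apply: H; lia.
- by lia.
apply: (@swap_flag_sum (Ordinal kd') (Ordinal kd)) => // F.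
have S n : n != k.+1 -> vertex (swap_flag (Ordinal kd') (Ordinal kd) F) n = vertex F n.
  by move=> ne; apply: swap_flag_vertex.
congr (_ * _ * _).
- by apply: eq_big_nat => l lk; apply: edge_val_ext; apply: S; lia.
- exact: (closed1_swap F (cb k) (erefl : Ordinal kd = (Ordinal kd').+1 :> nat)).
- by apply: uK => l lk; apply: S; lia.
Qed.

Definition cup (bs : nat -> grid -> grid -> rat) :=
  flag_sum (fun F => \prod_(0 <= l < d) edge_val (bs l) F l).

(** The coboundary contributes a difference of two terms that leave step [k] free: the value of [f]
    at its end attaches to the later steps, the value at its beginning to the earlier ones, and each
    sum vanishes by Stokes. *)
Lemma cup_cohom (bs bs' : nat -> grid -> grid -> rat) (k : nat) (f : grid -> rat) :
  (forall l, closed1 (bs l)) -> (k < d)%N ->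
  (forall l, l != k -> bs' l = bs l) ->
  (forall x s i, bs' k x (x + step_vec s i) - bs k x (x + step_vec s i) = f (x + step_vec s i) - f x) ->
  cup bs' = cup bs.
Proof.
move=> cb kd E Ek; apply/eqP; rewrite -subr_eq0 /cup -flag_sumB; apply/eqP.
have H1 : flag_sum (fun F => \prod_(0 <= l < k) edge_val (bs l) F l *
    (f (vertex F k.+1) * \prod_(k.+1 <= l < d) edge_val (bs l) F l)) = 0.
  apply: flag_sum_skip_l => // F F' H; rewrite H ?leqnn //; congr (_ * _).
  by apply: eq_big_nat => l lk; apply: edge_val_ext; apply: H; lia.
have H2 : flag_sum (fun F => \prod_(0 <= l < k) edge_val (bs l) F l * f (vertex F k) *
    \prod_(k.+1 <= l < d) edge_val (bs l) F l) = 0.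
  apply: flag_sum_skip_r => // F F' H; rewrite H ?leqnn //; congr (_ * _).
  by apply: eq_big_nat => l lk; apply: edge_val_ext; apply: H; lia.
rewrite -[RHS]subr0 -{1}H1 -H2 -flag_sumB; apply: eq_flag_sum => F _.
have split (c : nat -> grid -> grid -> rat) : \prod_(0 <= l < d) edge_val (c l) F l =
   \prod_(0 <= l < k) edge_val (c l) F l * edge_val (c k) F k * \prod_(k.+1 <= l < d) edge_val (c l) F l.
  by rewrite (@big_cat_nat _ _ _ k) //= ?(ltnW kd) // (big_ltn kd) mulrA.
rewrite !split.
have -> : \prod_(0 <= l < k) edge_val (bs' l) F l = \prod_(0 <= l < k) edge_val (bs l) F l.
  by apply: eq_big_nat => l lk; rewrite E //; lia.
have -> : \prod_(k.+1 <= l < d) edge_val (bs' l) F l = \prod_(k.+1 <= l < d) edge_val (bs l) F l.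
  by apply: eq_big_nat => l lk; rewrite E //; lia.
have := Ek (vertex F k) (F.1.2 (F.2 (Ordinal kd))) (F.2 (Ordinal kd)).
rewrite -(vertexSd F (Ordinal kd)) /= -/(edge_val (bs k) F k) -/(edge_val (bs' k) F k) => e.
have -> : edge_val (bs' k) F k = edge_val (bs k) F k + (f (vertex F k.+1) - f (vertex F k)) by rewrite -e; ring.
ring.
Qed.

End Flags.

(** * Cup products as determinants of periods *)

Section Periods.
Variables (d m : nat).
Hypothesis m_even : ~~ odd m.
Notation grid := {ffun 'I_d -> 'Z_m.+2}.
Notation flag := (flag d m).
Implicit Types (F : flag) (p q g : grid) (b : grid -> grid -> rat).

Definition translate g b x y := b (x + g) (y + g).
(** The translation-invariant, or harmonic, representative of the class of [b]. *)
Definition average b x y : rat := #|{: grid}|%:R^-1 * \sum_(g : grid) translate g b x y.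
Definition period b (i : 'I_d) : rat := \sum_(p : grid) b p (p + unit_vec m i).

Lemma unit_invariant (T : Type) (f : grid -> T) p :
  (forall q i, f (q + unit_vec m i) = f q) -> f p = f 0.
Proof.
move=> step; have -> : p = \sum_i unit_vec m i *+ p i.
  apply/ffunP => j; rewrite sum_ffunE (bigD1 j) //= big1 ?addr0 => [|i ne].
    by rewrite ffunMnE unit_vecE eqxx Zp_nat natr_Zp.
  by rewrite ffunMnE unit_vecE eq_sym (negbTE ne) mul0rn.
suff H g : f (g + \sum_i unit_vec m i *+ p i) = f g by rewrite -[X in f X]add0r H.
elim/big_ind: _ g => [g|x y Hx Hy g|i _ g]; first by rewrite addr0.
  by rewrite addrA Hy Hx.
by elim: (nat_of_ord (p i)) => [|n IH]; rewrite ?addr0 // mulrSr addrA step.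
Qed.

Lemma card_grid : #|{: grid}|%:R != 0 :> rat.
Proof. by rewrite pnatr_eq0 -lt0n; apply/card_gt0P; exists 0. Qed.

Lemma translate_closed g b : closed1 b -> closed1 (translate g b).
Proof.
move=> [anti sq]; split=> [x y|x i j]; first exact: anti.
rewrite /translate; have := sq (x + g) i j.
by rewrite !(addrAC x g) !(addrAC (x + _) g).
Qed.

Lemma average_closed b : closed1 b -> closed1 (average b).
Proof.
move=> cb; split=> [x y|x i j].
  rewrite /average -mulrN -sumrN; congr (_ * _); apply: eq_bigr => g _.
  exact: (translate_closed g cb).1.
rewrite /average -!mulrDr -!big_split /=; congr (_ * _); apply: eq_bigr => g _.
exact: (translate_closed g cb).2.
Qed.

Lemma average_dir b x s i : closed1 b ->
  average b x (x + step_vec m s i) = (-1) ^+ (~~ s) * (#|{: grid}|%:R^-1 * period b i).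
Proof.
move=> [anti _]; rewrite mulrCA /average /period; congr (_ * _).
rewrite mulr_sumr; case: s; rewrite /step_vec /= ?expr0 ?expr1.
  rewrite [RHS](reindex_inj (addrI x)) /=; apply: eq_bigr => g _.
  by rewrite /translate mul1r (addrAC x).
rewrite [RHS](reindex_inj (addrI (x - unit_vec m i))) /=; apply: eq_bigr => g _.
rewrite /translate mulN1r anti; congr (- b _ _).
by rewrite addrAC addrNK.
Qed.

Definition replace_at (bs : nat -> grid -> grid -> rat) (k : nat) b :=
  fun l => if l == k then b else bs l.

Lemma cup_replace_at bs k b : (k < d)%N -> cup (replace_at bs k b) =
  flag_sum (fun F => \prod_(0 <= l < k) edge_val (bs l) F l * edge_val b F k *
                 \prod_(k.+1 <= l < d) edge_val (bs l) F l).
Proof.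
move=> kd; apply: eq_flag_sum => F _.
rewrite (@big_cat_nat _ _ _ k) //= ?(ltnW kd) // (big_ltn kd) mulrA.
congr (_ * _ * _).
- by apply: eq_big_nat => l lk; rewrite /replace_at ifF //; apply/negbTE; lia.
- by rewrite /replace_at eqxx.
- by apply: eq_big_nat => l lk; rewrite /replace_at ifF //; apply/negbTE; lia.
Qed.

(* Translation by a unit vector changes a closed cochain by the coboundary of its values in that direction. *)
Lemma cup_translate bs k g : (forall l, closed1 (bs l)) -> (k < d)%N ->
  cup (replace_at bs k (translate g (bs k))) = cup bs.
Proof.
move=> cb kd.
have step g' (i : 'I_d) : cup (replace_at bs k (translate (g' + unit_vec m i) (bs k))) =
    cup (replace_at bs k (translate g' (bs k))).
  have cb' l : closed1 (replace_at bs k (translate g' (bs k)) l).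
    by rewrite /replace_at; case: ifP => _ //; apply: translate_closed.
  pose f x := translate g' (bs k) x (x + unit_vec m i).
  apply: (@cup_cohom _ _ m_even _ _ k f) => // [l lk|x s j].
    by rewrite /replace_at (negbTE lk).
  have trD y : translate (g' + unit_vec m i) (bs k) x y = translate g' (bs k) (x + unit_vec m i) (y + unit_vec m i).
    by rewrite /translate !addrA !(addrAC _ (unit_vec m i) g').
  have := closed1_dir x s true j i (translate_closed g' (cb k)).
  rewrite /replace_at eqxx /f /= trD [X in _ = _ + translate _ _ _ X -> _]addrAC; lra.
have step0 : cup (replace_at bs k (translate 0 (bs k))) = cup bs.
  apply: eq_flag_sum => F _; apply: eq_bigr => l _; rewrite /replace_at.
  by case: eqP => [->|//]; rewrite /edge_val /translate !addr0.
by rewrite -step0; apply: (@unit_invariant _ (fun g' => cup (replace_at bs k (translate g' (bs k))))).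
Qed.

Lemma cup_average bs k : (forall l, closed1 (bs l)) -> (k < d)%N ->
  cup (replace_at bs k (average (bs k))) = cup bs.
Proof.
move=> cb kd; rewrite cup_replace_at //.
have -> : cup bs = #|{: grid}|%:R^-1 * \sum_(g : grid) cup (replace_at bs k (translate g (bs k))).
  under eq_bigr => g _ do rewrite cup_translate //.
  by rewrite sumr_const -[X in _ * X]mulr_natl mulKf // card_grid.
under [in RHS]eq_bigr => g _ do rewrite cup_replace_at //.
rewrite /flag_sum exchange_big mulr_sumr; apply: eq_bigr => F _ /=.
rewrite -mulr_sumr -mulr_suml -mulr_sumr.
rewrite {2}/edge_val /average; ring.
Qed.

Lemma cup_const bs : (forall l, closed1 (bs l)) ->
  cup (fun l => average (bs l)) = cup bs.
Proof.
move=> cb; pose c k l := if (l < k)%N then average (bs l) else bs l.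
have H k : (k <= d)%N -> cup (c k) = cup bs.
  elim: k => [//|k IH] kd; rewrite -IH; last by lia.
  have <- : cup (replace_at (c k) k (average (c k k))) = cup (c k).
    apply: cup_average => // l; rewrite /c; case: ifP => _ //; exact: average_closed.
  apply: eq_flag_sum => F _; apply: eq_bigr => l _; rewrite /replace_at /c ltnS leq_eqVlt.
  by case: eqP => [->|//]; rewrite ltnn.
rewrite -(H d) //; apply: eq_flag_sum => F _; apply: eq_big_nat => l lk.
by rewrite /c; case/andP: lk => _ ->.
Qed.

Definition cup_scale : rat := #|[set x : grid * {ffun 'I_d -> bool} | is_even_vertex x.1]|%:R.

Lemma cup_scale_neq0 : cup_scale != 0.
Proof.
rewrite pnatr_eq0 -lt0n; apply/card_gt0P; exists (0, [ffun=> true]).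
by rewrite inE; apply/forallP => i; rewrite ffunE.
Qed.

(** After averaging, the value on a step depends only on its direction, and its sign cancels the one
    in [flag_sign]. Flags with the same permutation contribute equally, which leaves the Leibniz
    formula. *)
Theorem cup_det bs : (forall l, closed1 (bs l)) ->
  cup bs = cup_scale * \det (\matrix_(l < d, i < d) (#|{: grid}|%:R^-1 * period (bs l) i)).
Proof.
move=> cb; rewrite -cup_const // /cup /flag_sum /cup_scale -sum1_card natr_sum mulr_suml.
rewrite (eq_bigr (fun F => (-1) ^+ F.2 * \prod_(l < d) (#|{: grid}|%:R^-1 * period (bs l) (F.2 l)))).
  rewrite (eq_bigl (fun F : flag => is_even_vertex F.1.1 && true)); last by move=> F; rewrite andbT.
  rewrite -(pair_big (fun x : grid * {ffun 'I_d -> bool} => is_even_vertex x.1) xpredT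
    (fun _ s => (-1) ^+ odd_perm s * \prod_(l < d) (#|{: grid}|%:R^-1 * period (bs l) (s l)))) /=.
  apply: eq_big => [x|x _]; first by rewrite inE.
  rewrite mul1r /determinant; apply: eq_bigr => s _; congr (_ * _).
  by apply: eq_bigr => l _; rewrite mxE.
move=> F _; rewrite /flag_sign big_mkord -mulrA; congr (_ * _).
rewrite (reindex_inj (@perm_inj _ F.2)) /= -big_split; apply: eq_bigr => l _ /=.
rewrite /edge_val vertexSd average_dir // mulrA.
by case: (F.1.2 _); rewrite /= ?expr0 ?expr1 ?mulN1r ?opprK ?mul1r.
Qed.

Definition axis_vec (i : 'I_d) (t : 'Z_m.+2) : grid := [ffun j => if j == i then t else 0].

Lemma axis_vecD i t : axis_vec i (t + 1) = axis_vec i t + unit_vec m i.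
Proof.
by apply/ffunP => j; rewrite gridDE unit_vecE !ffunE; case: eqP => _; rewrite ?addr0.
Qed.

(** Parallel lines carry the same sum: by closedness the difference telescopes around the closed
    line. *)
Lemma period_line b i : closed1 b -> period b i =
  #|{: grid}|%:R * (m.+2%:R^-1 * \sum_(t : 'Z_m.+2) b (axis_vec i t) (axis_vec i (t + 1))).
Proof.
move=> cb; pose L p := \sum_(t : 'Z_m.+2) b (p + axis_vec i t) (p + axis_vec i t + unit_vec m i).
have L0 p : L p = L 0.
  apply: unit_invariant => q j; apply/eqP; rewrite -subr_eq0 /L -sumrB; apply/eqP.
  pose f t := b (q + axis_vec i t) (q + axis_vec i t + unit_vec m j).
  rewrite (eq_bigr (fun t => f (t + 1) - f t)) => [|t _].
    by rewrite sumrB [X in _ - X](reindex_inj (addIr 1)) subrr.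
  have := closed1_dir (q + axis_vec i t) true true i j cb.
  rewrite /step_vec /f axis_vecD !addrA (addrAC q (unit_vec m j)); lra.
have E : m.+2%:R * period b i = #|{: grid}|%:R * L 0.
  rewrite !mulr_natl -[in RHS]sumr_const -(eq_bigr _ (fun p _ => L0 p)).
  rewrite exchange_big /= -[in LHS](card_ord m.+2) -sumr_const /=.
  apply: eq_bigr => t _; rewrite /period.
  by rewrite (reindex_inj (addIr (axis_vec i t))).
have M0 : m.+2%:R != 0 :> rat by rewrite pnatr_eq0.
apply: (mulfI M0); rewrite E mulrCA mulVKf //; congr (_ * _).
by apply: eq_bigr => t _; rewrite add0r axis_vecD.
Qed.

End Periods.

(** * Labels on a grid torus *)

Section Labels.
Variables (d m : nat) (L : finType).
Hypothesis m_even : ~~ odd m.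
Notation grid := {ffun 'I_d -> 'Z_m.+2}.
Notation flag := (flag d m).
Implicit Types (F : flag) (p q x : grid) (A B C S : {set L}).

Definition near1 (s t : 'Z_m.+2) := [|| t == s, t == s + 1 | t == s - 1].
(** The second argument lies in the closure of the first: an edge has its two ends as further faces,
    a vertex has none. *)
Definition face1 (s t : 'Z_m.+2) := (t == s) || odd s && near1 s t.
Definition face p q := [forall i, face1 (p i) (q i)].

Lemma face1_refl s : face1 s s. Proof. by rewrite /face1 eqxx. Qed.

Variable lab : grid -> L.
Definition labels p : {set L} := [set lab q | q in [set q | face p q]].
Hypothesis few : forall p, (#|labels p| <= 2)%N.

Lemma lab_labels p : lab p \in labels p.
Proof. by apply: imset_f; rewrite inE; apply/forallP => i; apply: face1_refl. Qed.

Lemma step_vecE s i j : step_vec m s i j = if j == i :> 'I_d then unit_step m s else 0.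
Proof.
by case: s; rewrite /step_vec ?gridNE unit_vecE; case: eqP => _; rewrite ?oppr0.
Qed.

Lemma near1_dir s t e : near1 s t = near1 t s /\ near1 s (s + unit_step m e).
Proof.
split; last by rewrite /near1; case: e; rewrite eqxx !orbT.
have E (a b : 'Z_m.+2) : (a == b - 1) = (b == a + 1) by rewrite eq_sym subr_eq.
by rewrite /near1 [t == s]eq_sym (E t s) (E s t) [X in _ || X]orbC.
Qed.

Lemma labels_dir x i s : ~~ odd (x i) -> labels x \subset labels (x + step_vec m s i).
Proof.
move=> ev; apply: imsetS; apply/subsetP => q; rewrite !inE => /forallP H.
apply/forallP => j; have := H j; rewrite gridDE step_vecE.
case: (eqVneq j i) => [->|ne]; last by rewrite addr0.
rewrite /face1 (negbTE ev) /= orbF => /eqP ->; apply/orP; right.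
rewrite (odd_unit_step m_even) ev /=; have [E N] := near1_dir (x i) (x i + unit_step m s) s.
by rewrite -E.
Qed.

Lemma labels_dir_odd x i s : odd (x i) -> labels (x + step_vec m s i) \subset labels x.
Proof.
move=> od; have {2}-> : x = x + step_vec m s i + step_vec m (~~ s) i.
  by rewrite /step_vec; case: s; rewrite /= ?addrK ?addrNK.
by apply: labels_dir; rewrite gridDE step_vecE eqxx (odd_unit_step m_even) negbK.
Qed.

Section Antisym.
Variable u : {set L} -> {set L} -> rat.
Hypothesis anti : forall A B, u A B = - u B A.

(** There is room for a single growth, from one element to two. This is the combinatorial form of
    dimension one. *)
Lemma one_change A B C : A != set0 -> A \subset B -> B \subset C ->
  (#|C| <= 2)%N -> (A == B) || (B == C).
Proof.
rewrite -card_gt0 => A0 AB BC C2; rewrite !eqEcard AB BC /=.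
have := subset_leq_card AB; have := subset_leq_card BC; lia.
Qed.

Lemma labels_neq0 p : labels p != set0.
Proof. by apply/set0Pn; exists (lab p); apply: lab_labels. Qed.

Lemma u_trans x y z : labels x \subset labels y -> labels y \subset labels z ->
  u (labels x) (labels y) + u (labels y) (labels z) = u (labels x) (labels z).
Proof.
have u0 A : u A A = 0 by have := anti A A; lra.
move=> xy yz; case/orP: (one_change (labels_neq0 x) xy yz (few z)) => /eqP ->.
  by rewrite u0 add0r.
by rewrite u0 addr0.
Qed.

Definition label_cochain x y := u (labels x) (labels y).

(** The parities at [i] and [j] order the four corners by inclusion of cells, with one least and one
    greatest. Both ways from least to greatest are increasing chains, on which [u_trans] gives the
    same value. *)
Lemma label_cochain_closed : closed1 label_cochain.
Proof.
split=> [x y|x i j]; first exact: anti.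
rewrite /label_cochain; case: (eqVneq i j) => [->//|ij].
have E : x + unit_vec m j + unit_vec m i = x + unit_vec m i + unit_vec m j by rewrite addrAC.
have Ui : step_vec m true i = unit_vec m i by [].
have Uj : step_vec m true j = unit_vec m j by [].
have cj : (x + unit_vec m i) j = x j by rewrite gridDE unit_vecE eq_sym (negbTE ij) addr0.
have ci : (x + unit_vec m j) i = x i by rewrite gridDE unit_vecE (negbTE ij) addr0.
rewrite E -!Ui -!Uj in cj ci *.
have D1 := @labels_dir x i true; have D2 := @labels_dir x j true.
have D3 := @labels_dir (x + step_vec m true i) j true; have D4 := @labels_dir (x + step_vec m true j) i true.
have O1 := @labels_dir_odd x i true; have O2 := @labels_dir_odd x j true.
have O3 := @labels_dir_odd (x + step_vec m true i) j true.
have O4 := @labels_dir_odd (x + step_vec m true j) i true.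
rewrite cj in D3 O3; rewrite ci in D4 O4.
rewrite !Ui !Uj E in D1 D2 D3 D4 O1 O2 O3 O4 *.
case oi : (odd (x i)) D1 D4 O1 O4 => D1 D4 O1 O4;
case oj : (odd (x j)) D2 D3 O2 O3 => D2 D3 O2 O3.
- have := u_trans (O3 isT) (O1 isT); have := u_trans (O4 isT) (O2 isT).
  set a := labels x; set b := labels (x + unit_vec m i); set c := labels (x + unit_vec m j).
  set e := labels _; rewrite (anti a b) (anti a c) (anti b e) (anti c e); lra.
- have := u_trans (O1 isT) (D2 isT); have := u_trans (D3 isT) (O4 isT).
  set a := labels x; set b := labels (x + unit_vec m i); set c := labels (x + unit_vec m j).
  set e := labels _; rewrite (anti a b) (anti c e); lra.
- have := u_trans (O2 isT) (D1 isT); have := u_trans (D4 isT) (O3 isT).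
  set a := labels x; set b := labels (x + unit_vec m i); set c := labels (x + unit_vec m j).
  set e := labels _; rewrite (anti a c) (anti b e); lra.
- have := u_trans (D1 isT) (D3 isT); have := u_trans (D2 isT) (D4 isT); lra.
Qed.
End Antisym.

Lemma labels_step F (l : 'I_d) : is_even_vertex F.1.1 -> labels (vertex F l) \subset labels (vertex F l.+1).
Proof.
move=> /forallP ev; rewrite vertexSd; apply: labels_dir.
by rewrite vertexE permK ltnn addr0 ev.
Qed.

Lemma labels_mono F (k l : nat) : is_even_vertex F.1.1 -> (k <= l <= d)%N ->
  labels (vertex F k) \subset labels (vertex F l).
Proof.
move=> ev; elim: l => [|l IH] /andP[kl ld]; first by rewrite (_ : k = 0%N); last lia.
move: kl; rewrite leq_eqVlt => /orP[/eqP -> //|kl].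
apply: subset_trans (IH _) (labels_step (Ordinal ld) ev); lia.
Qed.

Lemma labels_change_once F (k l : 'I_d) : is_even_vertex F.1.1 ->
  labels (vertex F k) != labels (vertex F k.+1) -> labels (vertex F l) != labels (vertex F l.+1) -> k = l.
Proof.
move=> ev; wlog kl : k l / (k < l)%N => [W|].
  case: (ltngtP k l) => [kl|lk|/val_inj //] Hk Hl; first exact: W.
  by apply/esym/W.
have ld := ltn_ord l; have kd := ltn_ord k.
have M1 : labels (vertex F k) \subset labels (vertex F k.+1) by apply: labels_step.
have M2 : labels (vertex F k.+1) \subset labels (vertex F l) by apply: labels_mono => //; lia.
have M3 : labels (vertex F l) \subset labels (vertex F l.+1) by apply: labels_step.
have M4 := subset_trans M1 M2.
move=> n1 n2; case/orP: (one_change (labels_neq0 _) M4 M3 (few _)) => /eqP E.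
  by move: n1; rewrite eqEsubset M1 E M2.
by rewrite E eqxx in n2.
Qed.

Lemma labels_const F (k : 'I_d) (l : nat) : is_even_vertex F.1.1 ->
  labels (vertex F k) != labels (vertex F k.+1) -> (l <= d)%N ->
  labels (vertex F l) = if (l <= k)%N then labels (vertex F k) else labels (vertex F k.+1).
Proof.
move=> ev n1 ld; have M1 : labels (vertex F k) \subset labels (vertex F k.+1) by apply: labels_step.
have kd := ltn_ord k; case: leqP => lk.
  have Ml : labels (vertex F l) \subset labels (vertex F k) by apply: labels_mono => //; lia.
  case/orP: (one_change (labels_neq0 _) Ml M1 (few _)) => /eqP // E.
  by rewrite E eqxx in n1.
have Ml : labels (vertex F k.+1) \subset labels (vertex F l) by apply: labels_mono => //; lia.
case/orP: (one_change (labels_neq0 _) M1 Ml (few _)) => /eqP // E.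
by rewrite E eqxx in n1.
Qed.

(* With S and S' sets of one and two labels, this is the indicator cocycle of an edge of the barycentric subdivision
   of the nerve of the cover. *)
Definition jump S S' A B : rat := ((A == S) && (B == S'))%:R - ((A == S') && (B == S))%:R.

Lemma jump_anti S S' A B : jump S S' A B = - jump S S' B A.
Proof. by rewrite /jump opprB ![(B == _) && _]andbC. Qed.

Lemma jump_neq0 S S' A B : jump S S' A B != 0 -> A != B.
Proof.
apply: contraNneq => ->; by rewrite /jump andbC subrr.
Qed.

End Labels.

Lemma det_mx2 (A : 'M[rat]_2) :
  \det A = A ord0 ord0 * A (lift ord0 ord0) (lift ord0 ord0) -
           A ord0 (lift ord0 ord0) * A (lift ord0 ord0) ord0.
Proof.
rewrite (expand_det_row _ ord0) big_ord_recl big_ord1 /cofactor !det_mx11 !mxE /=.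
by rewrite expr0 expr1 mul1r mulN1r mulrN; congr (_ * A _ _ - _ * A _ _); apply: val_inj.
Qed.

Section Representative.
Variable m : nat.
Notation Zm := 'Z_m.+2.

Definition repr (z : Zm) : int := if (z * 2 < m.+2)%N then z%:Z else z%:Z - m.+2%:Z.
(* Symmetrised, so that it is an odd function also at the class of half the modulus. *)
Definition signed_rep (z : Zm) : rat := ((repr z)%:~R - (repr (- z))%:~R) / 2.

Lemma signed_rep_anti z : signed_rep (- z) = - signed_rep z.
Proof. by rewrite /signed_rep opprK -mulNr opprB. Qed.

Lemma repr_int (g : int) : (2 * `|g| < m.+2)%N -> repr (g%:~R) = g.
Proof.
have val_nat (a : nat) : (a < m.+2)%N -> ((a%:R : Zm) : nat) = a.
  by move=> am; rewrite Zp_nat /= modn_small.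
case: g => a.
  rewrite /repr -pmulrn absz_nat => H; rewrite val_nat; last lia.
  by rewrite mulnC H.
rewrite NegzE abszN absz_nat => H; rewrite /repr mulrNz -pmulrn.
have -> : ((- (a.+1%:R : Zm)) : nat) = (m.+2 - a.+1)%N.
  by rewrite /= val_nat ?modn_small //; lia.
by rewrite ifF; lia.
Qed.

Lemma signed_rep_int (g : int) : (2 * `|g| < m.+2)%N -> signed_rep (g%:~R) = g%:~R.
Proof.
move=> H; rewrite /signed_rep -[in repr (- _)]mulrNz !repr_int ?abszN // mulrNz.
set a := _%:~R; lra.
Qed.
End Representative.

(** * Labellings of products of circles *)

Section Core.
Variables (k m : nat) (L : finType).
Hypothesis m_even : ~~ odd m.
Hypothesis m_ge2 : (2 <= m)%N.
Notation n := k.+2.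
Notation Zm := 'Z_m.+2.
Notation pts := {ffun 'I_n -> 'I_n.+1 * Zm}.
Implicit Types (x y z : pts) (j : 'I_n).

Definition near x y := forall a, (y a).1 = (x a).1 /\ near1 (x a).2 (y a).2.
Definition small (z : Zm) := exists g : int, z = g%:~R /\ (8 * `|g| < m.+2)%N.
(** The sum of the n points after all circles but [e] are collapsed. It is symmetric, hence defined
    on the symmetric product, and its winding class is the generator of H^1 belonging to circle
    [e]. *)
Definition theta (e : 'I_n.+1) x : Zm := \sum_a (if (x a).1 == e then (x a).2 else 0).

Variable lab : 'I_n -> pts -> L.
Hypothesis lab_base : forall j x y,
  (forall a, x a = y a \/ (x a).2 = 0 /\ (y a).2 = 0) -> lab j x = lab j y.
Hypothesis lab_sym : forall j x (s : 'S_n), lab j [ffun a => x (s a)] = lab j x.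
Hypothesis lab_two : forall j x y1 y2 y3, near x y1 -> near x y2 -> near x y3 ->
  [\/ lab j y1 = lab j y2, lab j y2 = lab j y3 | lab j y3 = lab j y1].
Hypothesis lab_small : forall x y,
  (forall j, exists z, near y z /\ lab j z = lab j x) -> forall e, small (theta e x - theta e y).

(** * Labelled tori and the periods of their jump cochains *)

Section Torus.
Variables (d : nat) (iota : 'I_d -> 'I_n) (sg : 'I_d -> 'I_n.+1).
Hypothesis iota_inj : injective iota.

(** Positions outside the image of [iota] rest at the base point; this covers both the 2-tori that
    give parallel periods and the n-tori with [iota] the identity. *)
Definition torus_pt (p : {ffun 'I_d -> Zm}) : pts :=
  [ffun a => if [pick c | iota c == a] is Some c then (sg c, p c) else (ord0, 0)].

Lemma torus_pt_iota p c : torus_pt p (iota c) = (sg c, p c).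
Proof.
rewrite ffunE; case: pickP => [c' /eqP /iota_inj -> //|/(_ c)].
by rewrite eqxx.
Qed.

Lemma torus_pt_near p q : face p q -> near (torus_pt p) (torus_pt q).
Proof.
move=> /forallP H a; rewrite !ffunE; case: pickP => [c _|_] /=; last by rewrite /near1 eqxx.
split=> //; have := H c; rewrite /face1 => /orP[/eqP ->|/andP[_ //]].
by rewrite /near1 eqxx.
Qed.

Definition torus_label j p := lab j (torus_pt p).

Lemma torus_label_few j p : (#|labels (torus_label j) p| <= 2)%N.
Proof.
rewrite leqNgt; apply/negP => /card_gt2P [a [b [c [[]]]]].
move=> /imsetP[q1 H1 ->] /imsetP[q2 H2 ->] /imsetP[q3 H3 ->] [n1 n2 n3].
rewrite !inE in H1 H2 H3.
have := @lab_two j (torus_pt p) _ _ _ (torus_pt_near H1) (torus_pt_near H2) (torus_pt_near H3).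
by case=> /eqP; apply/negP.
Qed.

Definition axis j i (t : Zm) := lab j [ffun a => if a == ord0 then (i, t) else (ord0, 0)].
Definition axis_labels j i (t : Zm) : {set L} := [set axis j i t' | t' in [set t' | face1 t t']].

(** On an axis all points but one are at the base point, so symmetry may move the remaining one to
    position [ord0]. Periods therefore depend on the circle and not on the torus around it. *)
Lemma torus_label_axis j c t : torus_label j (axis_vec c t) = axis j (sg c) t.
Proof.
rewrite /torus_label -(lab_sym j _ (tperm ord0 (iota c))) /axis; apply: lab_base => a.
case: (eqVneq a ord0) => [->|a0].
  by left; rewrite ffunE tpermL torus_pt_iota !ffunE !eqxx.
right; split; last by rewrite ffunE (negbTE a0).
rewrite 2!ffunE; case: pickP => [c' /eqP E|//] /=.
rewrite ffunE ifN //; apply: contraNneq a0 => cc; move: E; rewrite cc.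
by move=> E; rewrite -(tpermK ord0 (iota c) a) -E tpermR.
Qed.

Lemma torus_labels_axis j c t : labels (torus_label j) (axis_vec c t) = axis_labels j (sg c) t.
Proof.
apply/setP => y; apply/imsetP/imsetP => [[q]|[t']]; rewrite inE => H ->.
  exists (q c); first by rewrite inE; have /forallP/(_ c) := H; rewrite ffunE eqxx.
  rewrite -torus_label_axis; congr (torus_label j _); apply/ffunP => i; rewrite ffunE.
  case: eqP => [->//|/eqP ne]; have /forallP/(_ i) := H.
  by rewrite ffunE (negbTE ne) /face1 /= orbF => /eqP.
exists (axis_vec c t'); last by rewrite torus_label_axis.
rewrite inE; apply/forallP => i; by rewrite !ffunE; case: eqP.
Qed.

Definition circle_period j S S' i : rat :=
  \sum_(t : Zm) jump S S' (axis_labels j i t) (axis_labels j i (t + 1)).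

Definition jump_cochain j S S' := label_cochain (torus_label j) (jump S S').

Lemma jump_cochain_closed j S S' : closed1 (jump_cochain j S S').
Proof. apply: label_cochain_closed => //; [exact: torus_label_few | exact: jump_anti]. Qed.

Lemma jump_cochain_period j S S' c :
  #|{: {ffun 'I_d -> Zm}}|%:R^-1 * period (jump_cochain j S S') c = m.+2%:R^-1 * circle_period j S S' (sg c).
Proof.
rewrite (period_line _ (jump_cochain_closed j S S')) mulKf ?card_grid //; congr (_ * _).
by apply: eq_bigr => t _; rewrite /jump_cochain /label_cochain !torus_labels_axis.
Qed.
End Torus.

Lemma m2_neq0 : m.+2%:R^-1 != 0 :> rat.
Proof. by rewrite invr_eq0 pnatr_eq0. Qed.

(* A curve carries no 2-dimensional cohomology: along a flag the labels change at most once, so the cup product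
   of two jump cochains of the same factor vanishes on every 2-torus. *)
Lemma circle_period_parallel j S S' R R' i l :
  circle_period j S S' i * circle_period j R R' l = circle_period j S S' l * circle_period j R R' i.
Proof.
(* Two circles need two different positions in the tuple; this is where n is at least 2. *)
pose iota (c : 'I_2) : 'I_n := inord c; pose sg (c : 'I_2) := if c == ord0 then i else l.
have iota_inj : injective iota.
  move=> a b /(congr1 (@nat_of_ord n)); rewrite /iota.
  by rewrite !inordK ?(leq_trans (ltn_ord _)) // => /val_inj.
pose bs (q : nat) := if q == 0%N then jump_cochain iota sg j S S' else jump_cochain iota sg j R R'.
have cb q : closed1 (bs q) by rewrite /bs; case: ifP => _; apply: jump_cochain_closed.
have: cup bs = 0.
  apply: big1 => F ev; rewrite (_ : \prod_(_ <= _ < _) _ = 0) ?mulr0 //.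
  rewrite big_nat_recl // big_nat1 /bs /= /edge_val /jump_cochain /label_cochain.
  apply/eqP; rewrite mulf_eq0 -implyNb; apply/implyP => H.
  apply/eqP; apply: contraTeq isT => H' /=.
  have := @labels_change_once _ _ _ m_even (torus_label iota sg j)
    (torus_label_few iota sg j) F ord0 (lift ord0 ord0) ev
    (jump_neq0 H) (jump_neq0 H').
  by move/(congr1 val).
rewrite (cup_det m_even cb) => /eqP; rewrite mulf_eq0 (negbTE (cup_scale_neq0 _ _)) /=.
rewrite det_mx2 !mxE /bs /= !jump_cochain_period // /sg /=.
rewrite !mulrA ![_ * m.+2%:R^-1]mulrC => /eqP.
have := m2_neq0; set w := _^-1 => w0 E.
apply: (mulfI w0); apply: (mulfI w0); apply/eqP; rewrite -subr_eq0; apply/eqP.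
rewrite -[RHS]E; ring.
Qed.

(** By [circle_period_parallel] the period vectors of factor [j] are multiples of one vector [w j];
    n vectors cannot span dimension n + 1. *)
Lemma circle_period_annihilator : exists c : 'I_n.+1 -> rat, (exists i, c i != 0) /\
  forall j S S', \sum_i c i * circle_period j S S' i = 0.
Proof.
have [w Hw] : exists w : 'I_n -> 'I_n.+1 -> rat, forall j S S', exists a, forall i,
    circle_period j S S' i = a * w j i.
  apply: (@fin_all_exists _ (fun=> 'I_n.+1 -> rat) (fun j w => forall S S',
    exists a, forall i, circle_period j S S' i = a * w i)) => j.
  case: (boolP [exists S, exists S', exists i, circle_period j S S' i != 0]).
    move=> /existsP[S /existsP[S' /existsP[i0 d0]]]; exists (circle_period j S S') => R R'.
    exists (circle_period j R R' i0 / circle_period j S S' i0) => i.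
    by apply: (mulIf d0); rewrite mulrAC mulfVK // mulrC -circle_period_parallel mulrC.
  rewrite negb_exists => /forallP H; exists (fun=> 0) => S S'; exists 0 => i.
  have := H S; rewrite negb_exists => /forallP/(_ S').
  by rewrite negb_exists => /forallP/(_ i); rewrite negbK mulr0 => /eqP.
pose W : 'M[rat]_(n.+1, n) := \matrix_(i, j) w j i.
have /rowV0Pn [v /sub_kermxP vW v0] : kermx W != 0.
  by rewrite kermx_eq0 -row_leq_rank -ltnNge ltnS rank_leq_col.
exists (fun i => v 0 i); split.
  by case/rV0Pn: v0 => i vi; exists i.
move=> j S S'; have [a Ha] := Hw j S S'.
under eq_bigr => i _ do rewrite Ha mulrCA.
rewrite -mulr_sumr; have /matrixP/(_ 0 j) := vW; rewrite !mxE => E.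
rewrite (_ : \sum_i _ = 0) ?mulr0 // -[RHS]E; apply: eq_bigr => i _.
by rewrite mxE.
Qed.

(** * The combination of n-tori and its pairing with the angle product *)

Section Tori.
Variable k0 : 'I_n.+1.
(* In the i-th torus the first coordinate runs along the circle i, the others along the circles other than k0. *)
Definition circle_of (i : 'I_n.+1) (c : 'I_n) := if c == ord0 then i else lift k0 c.
Notation grid := {ffun 'I_n -> Zm}.
Definition circle_label i j (p : grid) : L := torus_label id (circle_of i) j p.
Definition face_labels i (p : grid) : {ffun 'I_n -> {set L}} := [ffun j => labels (circle_label i j) p].
(* A grid point with the given labels; arbitrary if there is none. *)
Definition label_point (T : {ffun 'I_n -> {set L}}) : pts :=
  if [pick ip : 'I_n.+1 * grid | face_labels ip.1 ip.2 == T] is Some ip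
  then torus_pt id (circle_of ip.1) ip.2 else [ffun=> (ord0, 0)].
(* The winding cochain of circle e up to a coboundary, in a form that depends on the labels only. *)
Definition theta_cochain i e (x y : grid) : rat :=
  signed_rep (theta e (label_point (face_labels i y)) - theta e (label_point (face_labels i x))).

(** Injectivity of the embedding enters here. Equal label sets at [p] and [p'] give, for each
    factor, a face of [p'] with the label of [p], which is the hypothesis of [lab_small]. *)
Lemma label_point_small i p e : small (theta e (label_point (face_labels i p)) - theta e (torus_pt id (circle_of i) p)).
Proof.
rewrite /label_point; case: pickP => [[i' p'] /= /eqP E|/(_ (i, p))]; last by rewrite eqxx.
have [g [Eg Hg]] : small (theta e (torus_pt id (circle_of i) p) - theta e (torus_pt id (circle_of i') p')).
  apply: lab_small => j; have := lab_labels (circle_label i j) p.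
  have /ffunP/(_ j) := E; rewrite !ffunE => <- /imsetP[q]; rewrite inE => Hq Eq.
  by exists (torus_pt id (circle_of i') q); split; [apply: torus_pt_near | apply: esym Eq].
by exists (- g); rewrite mulrNz -Eg opprB abszN.
Qed.

Lemma theta_torus e i p : theta e (torus_pt id (circle_of i) p) = \sum_c (if circle_of i c == e then p c else 0).
Proof.
by rewrite /theta; apply: eq_bigr => c _; rewrite -[c]/(id c) torus_pt_iota.
Qed.

Lemma theta_torus_dir e i p s c :
  theta e (torus_pt id (circle_of i) (p + step_vec m s c)) - theta e (torus_pt id (circle_of i) p) =
  if circle_of i c == e then unit_step m s else 0.
Proof.
rewrite !theta_torus -sumrB (bigD1 c) //= big1 ?addr0 => [|c' ne].
  rewrite gridDE step_vecE eqxx; case: ifP => _; last by rewrite subr0.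
  by rewrite addrC addKr.
rewrite gridDE step_vecE (negbTE ne) addr0; case: ifP => _; by rewrite subrr.
Qed.

(** Here [g] is the integer error made in replacing a grid point by the point chosen from its
    labels. *)
Lemma theta_cochain_edge i e : exists g : grid -> int, forall (x : grid) s c,
  theta_cochain i e x (x + step_vec m s c) =
  (-1) ^+ (~~ s) * (circle_of i c == e)%:R + (g (x + step_vec m s c))%:~R - (g x)%:~R.
Proof.
have [g Hg] : exists g : grid -> int, forall p,
    theta e (label_point (face_labels i p)) - theta e (torus_pt id (circle_of i) p) = (g p)%:~R /\
    (8 * `|g p| < m.+2)%N.
  apply: (@fin_all_exists _ (fun=> int) (fun p g =>
    theta e (label_point (face_labels i p)) - theta e (torus_pt id (circle_of i) p) = g%:~R /\
    (8 * `|g| < m.+2)%N)) => p.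
  by have [g Hg] := label_point_small i p e; exists g.
exists g => x s c; set y := x + _.
have [Ex Hx] := Hg x; have [Ey Hy] := Hg y.
pose dl : int := if circle_of i c == e then (if s then 1 else -1) else 0.
have dl1 : (`|dl| <= 1)%N by rewrite /dl; case: ifP => _; case: (s).
have Ed : theta e (torus_pt id (circle_of i) y) - theta e (torus_pt id (circle_of i) x) = dl%:~R.
  by rewrite theta_torus_dir /dl /unit_step; case: ifP => _ //; case: (s).
rewrite /theta_cochain (_ : _ - _ = (dl + g y - g x)%:~R); last first.
  rewrite rmorphB rmorphD /= -Ed -Ey -Ex; ring.
(* A step of size at most 1 and two errors below an eighth of the modulus stay below half of it, as
   the modulus is at least 4; so no wrap-around occurs. *)
rewrite signed_rep_int; last by lia.
rewrite rmorphB rmorphD /=; congr (_ + _ - _).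
by rewrite /dl; case: ifP => _; case: (s); rewrite ?expr0 ?expr1 ?mulr0 ?mulr1.
Qed.

Lemma theta_cochain_closed i e : closed1 (theta_cochain i e).
Proof.
have [g Hg] := theta_cochain_edge i e.
split=> [x y|x a b]; first by rewrite /theta_cochain -signed_rep_anti opprB.
have H (x' : grid) c : theta_cochain i e x' (x' + unit_vec m c) =
    (circle_of i c == e)%:R + (g (x' + unit_vec m c))%:~R - (g x')%:~R.
  by rewrite -[unit_vec m c]/(step_vec m true c) Hg mul1r.
rewrite !H (addrAC x (unit_vec m b)); ring.
Qed.

Lemma theta_cochain_period i e c : #|{: grid}|%:R^-1 * period (theta_cochain i e) c = (circle_of i c == e)%:R.
Proof.
have [g Hg] := theta_cochain_edge i e.
have H (x' : grid) : theta_cochain i e x' (x' + unit_vec m c) =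
    (circle_of i c == e)%:R + ((g (x' + unit_vec m c))%:~R - (g x')%:~R).
  by rewrite -[unit_vec m c]/(step_vec m true c) Hg mul1r addrA.
rewrite /period (eq_bigr _ (fun p _ => H p)) big_split /= sumrB.
rewrite [X in _ + (_ - X)](reindex_inj (addIr (unit_vec m c))) /= subrr addr0.
by rewrite sumr_const -[X in _ * X]mulr_natl mulKf // card_grid.
Qed.

Definition theta_family i (l : nat) := theta_cochain i (circle_of k0 (inord l)).

(** The period matrix is lower triangular with diagonal 1 except for its first entry, which tests
    whether [i] is [k0]: for any other [i] no coordinate runs along circle [k0]. *)
Lemma cup_theta i : cup (theta_family i) = cup_scale n m * (i == k0)%:R.
Proof.
rewrite (cup_det m_even) => [|l]; last exact: theta_cochain_closed.
congr (_ * _); rewrite (_ : \matrix_(_, _) _ = \matrix_(l, c) (circle_of i c == circle_of k0 l)%:R); last first.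
  by apply/matrixP => l c; rewrite !mxE theta_cochain_period inord_val.
rewrite det_trig; last first.
  apply/is_trig_mxP => l c lc; rewrite mxE /circle_of.
  have -> : (c == ord0) = false by apply/negbTE; rewrite -val_eqE /=; lia.
  case: (l == ord0); first by rewrite eq_sym (negbTE (neq_lift _ _)).
  by rewrite (inj_eq lift_inj) -val_eqE gtn_eqF.
rewrite big_ord_recl mxE /circle_of /= big1 ?mulr1 // => l _.
by rewrite mxE /= eqxx.
Qed.
Notation flag := (flag n m).
Notation lpath := {ffun 'I_n.+1 -> {ffun 'I_n -> {set L}}}.
Definition path_of i (F : flag) : lpath := [ffun l : 'I_n.+1 => face_labels i (vertex F l)].
Definition path_weight (T : lpath) : rat := \prod_(l < n)
  signed_rep (theta (circle_of k0 l) (label_point (T (lift ord0 l))) -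
              theta (circle_of k0 l) (label_point (T (widen_ord (leqnSn n) l)))).
Definition path_count i (T : lpath) : rat :=
  \sum_(F : flag | is_even_vertex F.1.1 && (path_of i F == T)) flag_sign F.

Lemma cup_theta_path i : cup (theta_family i) = \sum_T path_count i T * path_weight T.
Proof.
rewrite /cup /flag_sum (partition_big (path_of i) predT) //=; apply: eq_bigr => T _.
rewrite /path_count mulr_suml; apply: eq_bigr => F /andP[_ /eqP <-]; congr (_ * _).
rewrite big_mkord /path_weight; apply: eq_bigr => l _.
by rewrite /edge_val /theta_family /theta_cochain inord_val !ffunE lift0.
Qed.

Lemma prod_indicator (P : pred 'I_n) : \prod_(l < n) (P l)%:R = [forall l, P l]%:R :> rat.
Proof.
case: forallP => [H|H]; first by apply: big1 => l _; rewrite H.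
have /forallPn [l nP] : ~~ [forall l, P l] by apply/forallP.
by rewrite (bigD1 l) //= (negbTE nP) mul0r.
Qed.

(** A nonzero weight forces a change of labels at each of the n steps, while each of the n factors
    changes at most once. So [r] is a bijection, every step changes exactly one factor, and the
    indicator of the path is a product of jump cochains, one per factor. *)
Lemma path_countE T : path_weight T != 0 -> (exists i0 F0, is_even_vertex F0.1.1 /\ path_of i0 F0 = T) ->
  exists (r : 'I_n -> 'I_n) (S S' : 'I_n -> {set L}), forall i,
  path_count i T = cup (fun l => jump_cochain id (circle_of i) (r (inord l)) (S (inord l)) (S' (inord l))).
Proof.
move=> w0 [i0 [F0 [ev0 ET]]].
have id_inj : injective (@id 'I_n) by [].
have sub i j (F : flag) (l : 'I_n) (ev : is_even_vertex F.1.1) :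
  labels (circle_label i j) (vertex F l) \subset labels (circle_label i j) (vertex F l.+1) by apply: labels_step.
have [r Hr] : exists r : 'I_n -> 'I_n, forall l : 'I_n,
    labels (circle_label i0 (r l)) (vertex F0 l) != labels (circle_label i0 (r l)) (vertex F0 l.+1).
  apply: (@fin_all_exists _ (fun=> 'I_n) (fun (l : 'I_n) j =>
    labels (circle_label i0 j) (vertex F0 l) != labels (circle_label i0 j) (vertex F0 l.+1))) => l.
  apply/existsP; apply: contraNT w0; rewrite negb_exists => /forallP H.
  rewrite /path_weight (bigD1 l) //= -ET (_ : path_of _ _ _ = path_of i0 F0 (widen_ord (leqnSn n) l)).
    by rewrite subrr /signed_rep oppr0 subrr !mul0r.
  rewrite [LHS]ffunE [RHS]ffunE; apply/ffunP => j; rewrite !ffunE lift0 /=.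
  by have := H j; rewrite negbK => /eqP.
have r_inj : injective r.
  move=> l l' E; have H := Hr l'; rewrite -E in H.
  exact: (labels_change_once m_even (torus_label_few id (circle_of i0) (r l)) ev0 (Hr l) H).
pose S l := labels (circle_label i0 (r l)) (vertex F0 l).
pose S' l := labels (circle_label i0 (r l)) (vertex F0 l.+1).
exists r, S, S' => i.
pose P (F : flag) := [pred l : 'I_n | (labels (circle_label i (r l)) (vertex F l) == S l) &&
                      (labels (circle_label i (r l)) (vertex F l.+1) == S' l)].
have EP F : is_even_vertex F.1.1 -> (path_of i F == T) = [forall l, P F l].
  move=> ev; rewrite -ET; apply/eqP/forallP => [/ffunP E l|H].
    have E1 := E (widen_ord (leqnSn n) l); have E2 := E (lift ord0 l).
    rewrite !ffunE lift0 in E1 E2.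
    have /ffunP/(_ (r l)) := E1; have /ffunP/(_ (r l)) := E2.
    by rewrite !ffunE /= /S /S' => -> ->; rewrite !eqxx.
  apply/ffunP => l'; rewrite [LHS]ffunE [RHS]ffunE; apply/ffunP => j; rewrite !ffunE.
  (* An injective map between the n steps and the n factors is onto, so every factor has its step of
     change. *)
  have -> : j = r (invF r_inj j) by rewrite f_invF.
  set l := invF r_inj j; have /andP[/eqP Ea /eqP Eb] := H l.
  rewrite (labels_const m_even (torus_label_few id (circle_of i0) (r l)) ev0 (Hr l)); last by rewrite -ltnS.
  rewrite (labels_const m_even (torus_label_few id (circle_of i) (r l)) (k := l) ev); first last.
  - by rewrite -ltnS.
  - by rewrite -/(circle_label i (r l)) Ea Eb; apply: Hr.
  by rewrite -!/(circle_label _ _) Ea Eb.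
rewrite /path_count /cup /flag_sum [LHS]big_mkcondr; apply: eq_bigr => F ev.
rewrite EP // big_mkord.
rewrite (_ : \prod_(_ < _) _ = [forall l, P F l]%:R); first by case: ifP => _; rewrite ?mulr1 ?mulr0.
rewrite -prod_indicator; apply: eq_bigr => l _; rewrite /edge_val /jump_cochain /label_cochain inord_val /jump.
(* The negative half of [jump] would need the label set to shrink, but it only grows along a flag
   that starts at a vertex. *)
rewrite -!/(circle_label _ _) [X in _ - X](_ : _ = 0) ?subr0 //.
case: andP => [[/eqP Ea /eqP Eb]|//]; have := sub i (r l) F l ev; rewrite Ea Eb => H.
by move: (Hr l); rewrite eqEsubset (sub i0 (r l) F0 l ev0) H.
Qed.

(** The matrices for different [i] differ only in their first column. Expanding along it leaves
    cofactors independent of [i], multiplied by combinations of periods that [c] annihilates. *)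
Lemma path_count_annihilated (c : 'I_n.+1 -> rat) T :
  (forall j S S', \sum_i c i * circle_period j S S' i = 0) -> path_weight T != 0 ->
  \sum_i c i * path_count i T = 0.
Proof.
move=> Hc w0.
case: (boolP [exists i0, exists F0 : flag, is_even_vertex F0.1.1 && (path_of i0 F0 == T)]); last first.
  rewrite negb_exists => /forallP H; apply: big1 => i _.
  rewrite /path_count big_pred0 ?mulr0 // => F; apply/negbTE.
  by have := H i; rewrite negb_exists => /forallP.
move=> /existsP[i0 /existsP[F0 /andP[ev /eqP E]]].
have [r [S [S' HE]]] := path_countE w0 (ex_intro _ i0 (ex_intro _ F0 (conj ev E))).
pose D l e : rat := m.+2%:R^-1 * circle_period (r l) (S l) (S' l) e.
have id_inj : injective (@id 'I_n) by [].
have HB i : path_count i T = cup_scale n m * \det (\matrix_(l < n, a < n) D l (circle_of i a)).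
  rewrite HE (cup_det m_even) => [|l]; last exact: jump_cochain_closed.
  congr (_ * \det _); apply/matrixP => l a; rewrite !mxE inord_val.
  by rewrite jump_cochain_period.
under eq_bigr => i _ do rewrite HB (expand_det_col _ ord0) mulrCA mulr_sumr.
rewrite -mulr_sumr exchange_big /= big1 ?mulr0 // => l _.
pose cof := cofactor (\matrix_(l < n, a < n) D l (circle_of k0 a)) l ord0.
rewrite (eq_bigr (fun i => c i * circle_period (r l) (S l) (S' l) i * (m.+2%:R^-1 * cof))) => [|i _].
  by rewrite -mulr_suml Hc mul0r.
rewrite mxE /D {1}/circle_of eqxx (_ : cofactor _ _ _ = cof); first by ring.
rewrite /cof /cofactor; congr (_ * \det _); apply/matrixP => a b; rewrite !mxE /circle_of.
by rewrite ![lift _ _ == _]eq_sym !(negbTE (neq_lift _ _)).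
Qed.
End Tori.

(** The angle product on the combination of tori is computed twice: it is zero when sorted by label
    paths, and a nonzero multiple of [c k0] by periods. *)
Theorem no_grid_labelling : False.
Proof.
have [c [[k0 ck0] Hc]] := circle_period_annihilator.
have : \sum_i c i * cup (theta_family k0 i) = 0.
  under eq_bigr => i _ do rewrite cup_theta_path mulr_sumr.
  rewrite exchange_big big1 // => T _ /=.
  case: (eqVneq (path_weight k0 T) 0) => [->|w0].
    by apply: big1 => i _; rewrite !mulr0.
  under eq_bigr => i _ do rewrite mulrA.
  by rewrite -mulr_suml path_count_annihilated ?mul0r.
under eq_bigr => i _ do rewrite cup_theta.
rewrite (bigD1 k0) //= eqxx big1 ?addr0 => [|i /negbTE ->]; last by rewrite !mulr0.
move/eqP; rewrite mulr1 mulf_eq0 (negbTE ck0) /=.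
by rewrite (negbTE (cup_scale_neq0 _ _)).
Qed.

End Core.

(** * Passage from pairs of natural numbers to finite types *)

Section Bridge.
Variable k : nat.
Notation n := k.+2.
Definition to_idx (a : 'I_n) : Idx n := exist _ (nat_of_ord a) (elimT ltP (ltn_ord a)).
Definition of_idx (i : Idx n) : 'I_n := Ordinal (introT ltP (proj2_sig i)).

Lemma of_idxK : cancel of_idx to_idx.
Proof. by move=> i; apply: idx_eq. Qed.

Lemma to_idxK : cancel to_idx of_idx.
Proof. by move=> a; apply: val_inj. Qed.

Lemma modnE a b : (0 < b)%N -> (a %% b)%N = Nat.modulo a b.
Proof.
move=> b0; apply: (PeanoNat.Nat.mod_unique _ _ (a %/ b)%N).
  by apply/ltP; rewrite ltn_mod.
by rewrite {1}(divn_eq a b) mulnC.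
Qed.

Variable m : nat.
Notation Zm := 'Z_m.+2.
Notation pts := {ffun 'I_n -> 'I_n.+1 * Zm}.
Definition nat_pt (x : pts) (i : Idx n) : nat * nat :=
  (nat_of_ord (x (of_idx i)).1, nat_of_ord (x (of_idx i)).2).

Lemma nat_pt_valid x : valid_pt n m.+2 (nat_pt x).
Proof.
move=> i; split; apply/leP; rewrite /nat_pt /=; last exact: ltn_ord.
by rewrite -ltnS; apply: ltn_ord.
Qed.

Lemma near1_grid (s t : Zm) : near1 s t -> grid_near m.+2 s t.
Proof.
have E (z : Zm) : nat_of_ord (z + 1) = Nat.modulo (z + 1)%N m.+2.
  by rewrite -modnE //= modn_small.
case/or3P => /eqP ->; first by left.
  by right; left; rewrite E.
by right; right; rewrite -[in LHS](subrK 1 s) E.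
Qed.

Lemma nat_pt_near x y : near x y -> pt_near n m.+2 (nat_pt x) (nat_pt y).
Proof.
by move=> H i; have [E N] := H (of_idx i); rewrite /nat_pt /= E; split=> //; apply: near1_grid.
Qed.

Lemma nat_pt_coord x (a : 'I_n) (e : 'I_n.+1) :
  ((if Nat.eqb (fst (nat_pt x (to_idx a))) e then snd (nat_pt x (to_idx a)) else 0%N)%:R : Zm) =
  if (x a).1 == e then (x a).2 else 0.
Proof.
rewrite /nat_pt to_idxK /=; case: PeanoNat.Nat.eqb_spec => [/val_inj ->|ne].
  by rewrite eqxx natr_Zp.
by rewrite ifN //; apply/eqP => E; apply: ne; rewrite E.
Qed.

Lemma small_sum (x y : pts) (e : 'I_n.+1) (s : Idx n -> Idx n) : is_perm n s ->
  (forall a, smallZ m.+2 n (BinInt.Z.sub (coordZ (nat_pt x a) e) (coordZ (nat_pt y (s a)) e))) ->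
  small (theta e x - theta e y).
Proof.
move=> [s' [sK Ks]] H.
pose t (a : 'I_n) := of_idx (s (to_idx a)).
have t_inj : injective t.
  move=> a b /(congr1 to_idx); rewrite !of_idxK => /(congr1 s'); rewrite !sK.
  by move/(congr1 of_idx); rewrite !to_idxK.
have M0 w : (m.+2 * w)%N%:R = 0 :> Zm.
  by rewrite natrM (_ : m.+2%:R = 0) ?mul0r //; apply: pchar_Zp.
have ex a : exists g : int, (if (x a).1 == e then (x a).2 else 0) -
    (if (y (t a)).1 == e then (y (t a)).2 else 0) = g%:~R /\ (8 * n * `|g| < m.+2)%N.
  have [q [u [v [Hq Huv]]]] := smallZ_nat _ _ _ _ _ (H (to_idx a)).
  rewrite -nat_pt_coord -nat_pt_coord of_idxK.
  have q8 : (8 * n * q < m.+2)%N by apply/ltP; rewrite -!multE in Hq *.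
  case: Huv => /(congr1 (fun c : nat => c%:R : Zm)).
    rewrite plusE multE (natrD _ _ (m.+2 * u)) (natrD _ _ (m.+2 * v)) !M0 !addr0 natrD => ->.
    by exists q%:Z; rewrite addrAC subrr add0r pmulrn absz_nat.
  rewrite plusE multE (natrD _ _ (m.+2 * u)) (natrD _ _ (m.+2 * v)) !M0 !addr0 natrD => <-.
  exists (- q%:Z); rewrite abszN absz_nat mulrNz opprD addrA subrr sub0r.
  by split.
have [g Hg] := @fin_all_exists _ (fun=> int) _ ex.
exists (\sum_a g a); split.
  rewrite /theta [X in _ - X](reindex_inj t_inj) -sumrB rmorph_sum /=.
  by apply: eq_bigr => a _; have [-> _] := Hg a.
have le1 : (`|(\sum_a g a)%R| <= \sum_a `|g a|)%N.
  elim/big_ind2: _ => // a1 b1 a2 b2 H1 H2; lia.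
(* Each strict bound is used as [8 * n * |g a| <= m.+1]; the sum of n of them allows the factor n to
   be cancelled exactly. *)
have le2 : (8 * n * \sum_a `|g a| <= n * m.+1)%N.
  have -> : (n * m.+1 = \sum_(a < n) m.+1)%N by rewrite sum_nat_const card_ord.
  rewrite big_distrr /=; apply: leq_sum => a _.
  by have [_ h] := Hg a; rewrite -ltnS.
have : (n * (8 * \sum_a `|g a|) <= n * m.+1)%N by rewrite mulnA [(n * 8)%N]mulnC.
rewrite leq_pmul2l // => le3.
by rewrite ltnS (leq_trans _ le3) // leq_mul2l le1.
Qed.

Variables (N : nat) (lab : Idx n -> (Idx n -> nat * nat) -> nat).
Hypothesis m_even : ~~ odd m.
Hypothesis m_ge2 : (2 <= m)%N.
Hypothesis lab_lt : forall j x, lt (lab j x) N.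
Hypothesis lab_base : forall j x y,
  (forall a, x a = y a \/ (snd (x a) = 0%N /\ snd (y a) = 0%N)) -> lab j x = lab j y.
Hypothesis lab_sym : forall j x s, is_perm n s -> lab j (fun a => x (s a)) = lab j x.
Hypothesis lab_two : forall j x y1 y2 y3, valid_pt n m.+2 x -> valid_pt n m.+2 y1 ->
  valid_pt n m.+2 y2 -> valid_pt n m.+2 y3 ->
  pt_near n m.+2 x y1 -> pt_near n m.+2 x y2 -> pt_near n m.+2 x y3 ->
  lab j y1 = lab j y2 \/ lab j y2 = lab j y3 \/ lab j y3 = lab j y1.
Hypothesis lab_small : forall x y, valid_pt n m.+2 x -> valid_pt n m.+2 y ->
  (forall j, exists z, valid_pt n m.+2 z /\ pt_near n m.+2 y z /\ lab j z = lab j x) ->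
  exists s, is_perm n s /\ forall a e, smallZ m.+2 n (BinInt.Z.sub (coordZ (x a) e) (coordZ (y (s a)) e)).

Lemma no_nat_labelling : False.
Proof.
pose L := 'I_N.
pose labm (j : 'I_n) (x : pts) : L := Ordinal (introT ltP (lab_lt (to_idx j) (nat_pt x))).
apply: (@no_grid_labelling k m L m_even m_ge2 labm).
- move=> j x y H; apply: val_inj; apply: lab_base => i; rewrite /nat_pt.
  by have [->|[-> ->]] := H (of_idx i); [left | right].
- move=> j x s; apply: val_inj => /=.
  rewrite -(lab_sym (to_idx j) (nat_pt x) (s := fun i => to_idx (s (of_idx i)))).
    congr (lab _ _); apply: FunctionalExtensionality.functional_extensionality => i.
    by rewrite /nat_pt to_idxK ffunE.
  exists (fun i => to_idx ((s^-1)%g (of_idx i))); split=> i; by rewrite to_idxK ?permK ?permKV of_idxK.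
- move=> j x y1 y2 y3 N1 N2 N3.
  have [E|[E|E]] := lab_two (to_idx j) (nat_pt_valid x) (nat_pt_valid y1)
    (nat_pt_valid y2) (nat_pt_valid y3) (nat_pt_near N1) (nat_pt_near N2) (nat_pt_near N3).
  + by apply: Or31; apply: val_inj.
  + by apply: Or32; apply: val_inj.
  + by apply: Or33; apply: val_inj.
- move=> x y H e.
  have [|s [ps Hs]] := lab_small (nat_pt_valid x) (nat_pt_valid y).
    move=> j; have [z [Nz Ez]] := H (of_idx j); exists (nat_pt z).
    split; first exact: nat_pt_valid; split; first exact: nat_pt_near.
    by have := congr1 val Ez; rewrite /= of_idxK.
  exact: small_sum ps (fun a => Hs a e).
Qed.
End Bridge.

Lemma even_modulus h : ~~ odd (Nat.add 2 (Nat.mul 2 h)).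
Proof. by rewrite plusE multE oddD oddM. Qed.

Lemma modulus_ge2 h : (2 <= Nat.add 2 (Nat.mul 2 h))%N.
Proof. by []. Qed.

End GridTorus.

Theorem mainTheorem19 (n : nat) (hn : (2 <= n)%nat)
  (Y : Idx n -> MSpace) (hY : forall j, curve (Y j)) :
  ~ exists f : (Idx n -> bouquet n) -> (forall j : Idx n, Y j),
      SP_embedding n Y f.
Proof.
  intros [f emb]. destruct n as [|[|k]]; [lia|lia|].
  destruct (embedding_grid_labelling (S (S k)) Y f ltac:(lia) hY emb)
    as [h [N [lab [H1 [H2 [H3 [H4 H5]]]]]]].
  (* The modulus [4 + 2 * h] is [m.+2] for [m = 2 + 2 * h]. *)
  exact (@GridTorus.no_nat_labelling k (2 + 2 * h) N lab (GridTorus.even_modulus h)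
    (GridTorus.modulus_ge2 h) H1 H2 H3 H4 H5).
Qed.
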